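(* Suppose that $\phi$ is sub-additive and that $\tau_1(Y)$ is integrable for every $Y\in\mathscr Y_2^\infty$. Then, on the original time scale (single arrivals), there exist almost surely exactly two perfect bi-infinite $\phi$-matchings. They coincide a.s. respectively with the two stationary perfect bi-infinite $\phi$-matchings induced by the sequences $(W^*_n)_{n\in\mathbb Z}$ and $(W^{**}_n)_{n\in\mathbb Z}$, and, for any $Y\in\mathscr Y_2^\infty$, they are obtained as the almost sure limits, as $k\to\infty$, of the infinite matchings $\mathbf M^{\{Y,-2k\}}_\infty(\phi)$ and $\mathbf M^{\{Y,-2k+1\}}_\infty(\phi)$, started from $Y$ respectively at time $-2k$ and at time $-2k+1$.
   Context: Model. $G=(\mathcal V,\mathcal E)$ is a finite connected simple graph; $\mathcal E(v)$ is the set of neighbors of $v$. $\mathcal V^*$ is the set of finite words over $\mathcal V$, $|w|$ the length of $w$, $|w|_i$ the number of occurrences of $i$ in $w$, $\emptyset$ the empty word. $\mathbb W=\{w\in\mathcal V^*:|w|_i|w|_j=0\ \forall (i,j)\in\mathcal E\}$ is the set of buffer contents (classes of stored items in order of arrival), $\mathbb W_2=\{w\in\mathbb W:|w|\text{ even}\}$, $\mathbb W_2(r)=\{w\in\mathbb W_2:|w|\le 2r\}$. $\mathcal S=\prod_{i\in\mathcal V}S_{\mathcal E(i)}$ is the set of lists of preferences ($S_A$ = permutations of $A$). An admissible matching policy $\phi$ consists of a probability distribution $\nu_\phi$ on $\mathcal S$ and a map $\odot_\phi:\mathbb W\times(\mathcal V\times\mathcal S)\to\mathbb W$ such that $w\odot_\phi(v,\sigma)=wv$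 if no letter of $w$ lies in $\mathcal E(v)$ (the arriving $v$-item is stored), and otherwise $w\odot_\phi(v,\sigma)$ is $w$ with one letter belonging to $\mathcal E(v)$ deleted, the deleted position being a function of $(w,v,\sigma)$ (the arriving item is matched with the item at that position and both leave). For $z=v_1\cdots v_n$, $\varsigma=\sigma_1\cdots\sigma_n$, $W_\phi(z,\varsigma)$ is obtained from $\emptyset$ by applying successively $\odot_\phi(v_1,\sigma_1),\dots,\odot_\phi(v_n,\sigma_n)$. $\phi$ is sub-additive if $|W_\phi(z'z'',\varsigma'\varsigma'')|\le|W_\phi(z',\varsigma')|+|W_\phi(z'',\varsigma'')|$ for all $z',z''\in\mathcal V^*$ and all $\varsigma',\varsigma''\in\mathcal S^*$ with $|\varsigma'|=|z'|$, $|\varsigma''|=|z''|$ whose letters have positive $\nu_\phi$-probability. Input. $\mu$ is a probability measure on $\mathcal V$ with full support. Work on $(\mathcal V\times\mathcal S)^{\mathbb Z}$ with the product measure $\bigotimes_{\mathbb Z}(\mu\otimes\nu_\phi)$, coordinates $(V_n,\Sigma_n)_{n\in\mathbb Z}$ and shift $\vartheta$ (so $V_n=V_0\circ\vartheta^n$, $\Sigma_n=\Sigma_0\circ\vartheta^n$): at time $n$ a single item of class $V_n$ with list of preferences $\Sigma_n$ arrives. $\mathscr Y_2^\infty=\bigcup_{r\ge1}\mathscr Y_2^r$, where $\mathscr Y_2^r$ is the set of $\mathbb W_2(r)$-valued r.v.'s. For $Y\in\mathscr Y_2^\infty$, let $W_0^{\{Y\}}=Y$, $W_{n+1}^{\{Y\}}=W_n^{\{Y\}}\odot_\phi(V_n,\Sigma_n)$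 for $n\ge0$, and $\tau_1(Y)=\inf\{n>0:W_{2n}^{\{Y\}}=\emptyset\}$. Stationary sequences. Under the assumptions of the claim, $(W^*_n)_{n\in\mathbb Z}$ is the a.s. unique $\mathbb W$-valued sequence satisfying $W^*_{n+1}=W^*_n\odot_\phi(V_n,\Sigma_n)$ for all $n\in\mathbb Z$, with $W^*_0\in\mathbb W_2$ and $W^*_{2n}=W^*_0\circ\vartheta^{2n}$ for all $n$; and $(W^{**}_n)_{n\in\mathbb Z}$ is the a.s. unique sequence satisfying the same recursion with $W^{**}_1\in\mathbb W_2$ and $W^{**}_{2n+1}=W^{**}_1\circ\vartheta^{2n}$ for all $n$. Each has a.s. a set of construction points (times $n$ where it equals $\emptyset$) unbounded in both directions, at even times for $W^*$ and at odd times for $W^{**}$; the bi-infinite matching it induces is obtained by matching with $\phi$, from the empty buffer, the arrivals within each block between successive construction points. Matchings. $\mathbf M^{\{Y,m\}}_\infty(\phi)$ is the random graph whose nodes are the items initially stored at time $m$ (the letters of $Y\circ\vartheta^m$) and all items arriving at times $n\ge m$, with an edge between two items when they are matched with each other by $\phi$ in the system started from $Y\circ\vartheta^m$ at time $m$. A matching is perfect if all its nodes have degree 1. A limit of such matchings as the starting time tends to $-\infty$ is a graph on the set of all arriving items $n\in\mathbb Z$ such that, for each $m_0\in\mathbb Z$, the restrictions of the matchings to items arriving from time $m_0$ onwards are eventually constant and equal to the restriction of the limit. A bi-infinite $\phi$-matching is any limit of $\mathbf M^{\{Y,m_k\}}_\infty(\phi)$ with $Y\in\mathscr Y_2^\infty$,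 along some sequence $m_k\to-\infty$. *)

(* Defs.v *)
From HB Require Import structures.
From mathcomp Require Import all_boot all_order all_algebra all_fingroup.
From mathcomp Require Import all_classical all_reals all_analysis.

Set Implicit Arguments.
Unset Strict Implicit.
Unset Printing Implicit Defensive.

Import Order.TTheory GRing.Theory Num.Theory.

Local Open Scope classical_set_scope.
Local Open Scope ring_scope.

Record sgraph := SGraph {
  vertex :> finType;
  edge : rel vertex;
  edge_sym : symmetric edge;
  edge_irr : irreflexive edge;
  edge_conn : forall i j, connect edge i j;
  vertex_card : (0 < #|vertex|)%N }.

(* For each class i, a permutation of the set of neighbours of i. *)
Definition prefs (G : sgraph) : Type :=
  {dffun forall i : G, {perm {j : G | edge i j}}}.

HB.instance Definition _ (G : sgraph) := Finite.on (prefs G).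

Definition arrival (G : sgraph) : Type := (G * prefs G)%type.

(* The canonical space of inputs indexed by the integers: coordinate n is the
   pair (V_n, Sigma_n). Measurable types are required to be inhabited, hence the
   (irrelevant) distinguished point. *)
Definition inputs (G : sgraph) : Type := int -> arrival G.

HB.instance Definition _ (G : sgraph) := gen_eqMixin (inputs G).
HB.instance Definition _ (G : sgraph) := gen_choiceMixin (inputs G).
HB.instance Definition _ (G : sgraph) := isPointed.Build (inputs G)
  (fun=> (enum_val (Ordinal (vertex_card G)), [ffun i => 1%g])).

(* Each coordinate ranges over a finite set, so that these cylinders generate
   the product sigma-algebra. *)
Definition cylinders (G : sgraph) : set (set (inputs G)) :=
  [set A | exists n a, A = [set w : inputs G | w n = a]].

Definition Omega (G : sgraph) := g_sigma_algebraType (cylinders (G := G)).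

Definition theta (G : sgraph) (m : int) (w : Omega G) : Omega G :=
  fun n => w (n + m).

Definition inW (G : sgraph) (w : seq G) : Prop :=
  forall i j : G, edge i j -> (count_mem i w * count_mem j w = 0)%N.

Definition inW2 (G : sgraph) (w : seq G) : Prop := inW w /\ ~~ odd (size w).

Definition inW2r (G : sgraph) (r : nat) (w : seq G) : Prop :=
  inW2 w /\ (size w <= 2 * r)%N.

Definition delete_at (T : Type) (p : nat) (s : seq T) : seq T :=
  take p s ++ drop p.+1 s.

(* The datum besides the law of the preferences is the position (from 0) of the
   stored item matched with the arriving one. It determines the map odot below,
   but is not determined by it: when a letter is repeated, distinct positions may
   give the same word and yet different matchings. *)
Record policy (R : realType) (G : sgraph) := Policy {
  nu : prefs G -> R;
  nu_ge0 : forall s, 0 <= nu s;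
  nu_sum1 : \sum_s nu s = 1;
  mpos : seq G -> arrival G -> nat;
  mposP : forall (w : seq G) (a : arrival G), inW w -> has (edge a.1) w ->
    (mpos w a < size w)%N /\ edge a.1 (nth a.1 w (mpos w a)) }.

Section dynamics.
Variables (R : realType) (G : sgraph) (phi : policy R G).

Definition odot (w : seq G) (a : arrival G) : seq G :=
  if has (edge a.1) w then delete_at (mpos phi w a) w else rcons w a.1.

Lemma inW_odot (w : seq G) (a : arrival G) : inW w -> inW (odot w a).
Proof.
move=> wW; rewrite /odot; case: ifPn => [_ i j ij|/hasPn wa i j ij].
  have le k : (count_mem k (delete_at (mpos phi w a) w) <= count_mem k w)%N.
    rewrite /delete_at -[X in (_ <= count_mem _ X)%N](cat_take_drop (mpos phi w a)).
    rewrite !count_cat leq_add2l -add1n -drop_drop.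
    by rewrite -[X in (_ <= count_mem _ X)%N](cat_take_drop 1) count_cat leq_addl.
  by apply/eqP; rewrite -leqn0 -(wW i j ij) leq_mul.
have a0 k : edge a.1 k -> count_mem k w = 0%N.
  move=> ak; apply/count_memPn/negP => /wa; by rewrite ak.
rewrite -cats1 !count_cat /= !addn0.
case: (a.1 =P i) => [ai|_]; case: (a.1 =P j) => [aj|_] /=.
- by move: ij; rewrite -ai -aj edge_irr.
- by rewrite (a0 j) ?ai// addn0 muln0.
- by rewrite (a0 i) ?aj 1?edge_sym// addn0 mul0n.
- by rewrite !addn0 wW.
Qed.

Definition Wphi (z : seq G) (s : seq (prefs G)) : seq G :=
  foldl odot [::] (zip z s).

Definition sub_additive : Prop :=
  forall (z1 z2 : seq G) (s1 s2 : seq (prefs G)),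
    size s1 = size z1 -> size s2 = size z2 ->
    (forall s, s \in s1 -> 0 < nu phi s) ->
    (forall s, s \in s2 -> 0 < nu phi s) ->
    (size (Wphi (z1 ++ z2) (s1 ++ s2)) <=
      size (Wphi z1 s1) + size (Wphi z2 s2))%N.

(* Buffer at time m + n when it contains y at time m; the content at time k is
   the one found by the item arriving at time k. *)
Fixpoint traj (w : Omega G) (m : int) (y : seq G) (n : nat) : seq G :=
  if n is n'.+1 then odot (traj w m y n') (w (m + n'%:Z)) else y.

Definition rv_word (Y : Omega G -> seq G) : Prop :=
  forall u : seq G, measurable [set w | Y w = u].

Definition Y2 (r : nat) (Y : Omega G -> seq G) : Prop :=
  rv_word Y /\ forall w, inW2r r (Y w).

Definition Y2inf (Y : Omega G -> seq G) : Prop :=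
  exists2 r : nat, (1 <= r)%N & Y2 r Y.

Definition tau1 (Y : Omega G -> seq G) (w : Omega G) : \bar R :=
  ereal_inf [set (n%:R%:E : \bar R) | n in
    [set n : nat | (0 < n)%N /\ traj w 0 (Y w) (2 * n)%N = [::]]].

(* inl k is the k-th letter of the initial buffer, inr n the item arriving at
   time n. *)
Definition item : Type := (nat + int)%type.

(* Buffer at time m + n, with the identities of the stored items. *)
Fixpoint ltraj (w : Omega G) (m : int) (y : seq G) (n : nat) :
    seq (item * G) :=
  if n is n'.+1 then
    let b := ltraj w m y n' in
    let a := w (m + n'%:Z) in
    if has (edge a.1) (unzip2 b) then delete_at (mpos phi (unzip2 b) a) b
    else rcons b (inr (m + n'%:Z), a.1)
  else zip [seq inl k | k <- iota 0 (size y)] y.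

Lemma unzip2_ltraj (w : Omega G) (m : int) (y : seq G) (n : nat) :
  unzip2 (ltraj w m y n) = traj w m y n.
Proof.
elim: n => [|n IHn] /=; first by rewrite unzip2_zip// size_map size_iota.
rewrite /odot -IHn; case: ifP => _; last by rewrite [LHS]map_rcons.
by rewrite /delete_at [LHS]map_cat map_take map_drop.
Qed.

(* The item arriving at time m + n finds x in the buffer and is matched with
   it. *)
Definition matched_on_arrival (w : Omega G) (m : int) (y : seq G) (n : nat)
    (x : item) : Prop :=
  let b := ltraj w m y n in
  let a := w (m + n%:Z) in
  has (edge a.1) (unzip2 b) /\
  x = (nth (inr (m + n%:Z), a.1) b (mpos phi (unzip2 b) a)).1.

(* Adjacency relation of the matching of the system started from y at time m. *)
Definition matching_from (w : Omega G) (m : int) (y : seq G)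
    (x x' : item) : Prop :=
  exists n : nat,
    (x' = inr (m + n%:Z) /\ matched_on_arrival w m y n x) \/
    (x = inr (m + n%:Z) /\ matched_on_arrival w m y n x').

Definition Minf (Y : Omega G -> seq G) (m : int) (w : Omega G) :
    item -> item -> Prop :=
  matching_from w m (Y (theta m w)).

(* Graphs on the set of all arriving items, given by their adjacency. *)
Definition zgraph : Type := int -> int -> Prop.

Definition perfect (M : zgraph) : Prop := forall i, exists! j, M i j.

Definition is_limit (Ms : nat -> item -> item -> Prop) (M : zgraph) : Prop :=
  forall m0 : int, \forall k \near \oo, forall i j : int,
    m0 <= i -> m0 <= j -> (Ms k (inr i) (inr j) <-> M i j).

Definition to_minfty (m : nat -> int) : Prop :=
  forall b : int, \forall k \near \oo, m k <= b.

(* Bi-infinite phi-matchings of the realization w of the input. *)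
Definition biinf_matching (w : Omega G) (M : zgraph) : Prop :=
  exists Y : Omega G -> seq G, Y2inf Y /\
  exists m : nat -> int, to_minfty m /\ is_limit (fun k => Minf Y (m k) w) M.

Definition consecutive_points (U : int -> seq G) (s t : int) : Prop :=
  [/\ s < t, U s = [::], U t = [::] & forall u, s < u < t -> U u <> [::]].

(* Within each block [s, t[ between successive construction points, the arrivals
   are matched starting from the empty buffer at time s. *)
Definition induced_matching (U : int -> Omega G -> seq G) (w : Omega G) : zgraph :=
  fun i j => exists s t : int,
    [/\ consecutive_points (U^~ w) s t, s <= i < t, s <= j < t &
        matching_from w s [::] (inr i) (inr j)].

Variable P : probability (Omega G) R.

(* P is the product over the integers of the measures mu (x) nu. *)
Definition product_measure (mu : G -> R) : Prop :=
  forall (J : seq int) (a : int -> arrival G), uniq J ->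
    P [set w | forall n, n \in J -> w n = a n] =
    (\prod_(n <- J) (mu (a n).1 * nu phi (a n).2))%:E.

Definition stationary_buffer (p : int) (U : int -> Omega G -> seq G) : Prop :=
  [/\ forall n, rv_word (U n) /\ forall w, inW (U n w),
      {ae P, forall w, forall n : int, U (n + 1) w = odot (U n w) (w n)},
      {ae P, forall w, inW2 (U p w)} &
      {ae P, forall w, forall n : int, U (2 * n + p) w = U p (theta (2 * n) w)}].

Definition the_stationary_buffer (p : int) (U : int -> Omega G -> seq G) :
    Prop :=
  stationary_buffer p U /\
  forall U', stationary_buffer p U' ->
    {ae P, forall w, forall n : int, U' n w = U n w}.

(* Compatibility with the shift of the input by an even number of time units. *)
Definition stationary_matching (M : Omega G -> zgraph) : Prop :=
  {ae P, forall w, forall n i j : int,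
    M (theta (2 * n) w) i j <-> M w (i + 2 * n) (j + 2 * n)}.

End dynamics.

(* Main.v *)
Require Import Defs.
From mathcomp Require Import all_boot all_order all_algebra.
From mathcomp Require Import all_classical all_reals all_analysis.
From mathcomp Require Import measurable_realfun measurable_fun_approximation.
From mathcomp Require Import zify ring lra.

(** Sampled at even times, the buffer is a Markov chain on the words of even length, and
integrability of [tau1] makes the empty word positive recurrent from every state. The
proof extracts two facts from this and couples all systems started in the remote past.

Erasing words. Any two vertices are joined by a walk of odd length ([odd_walks]).
Otherwise the graph is bipartite and the number of stored letters of one side minus the
number of those of the other side is a random walk with steps 1 and -1, which vanishes
when the buffer is empty. Started from 2 on the side of its drift, optional stopping
bounds below by 1/(k+1) the probability that the buffer is not empty at any of the first
k even times, and the harmonic series diverges. An odd walk from i to j provides a word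
of even length that is completely matched both alone and after the word ij
([odd_walk_erases]); sub-additivity then gives, for any finite list of contents, one word
that empties all of them ([erases_all]).

Coalescence. The tails of [tau1] are summable, so by the Borel-Cantelli lemma all but
finitely many of the systems started from y at even times before a deadline have been
emptied at some even time before it ([ae_hits]). Following empty times, the systems
started empty take only finitely many values at the deadline, hence are bounded there
([hits_bounded]). Say that t is a coalescence time if all systems started empty early
enough are empty at time 2t. The event that no coalescence occurred up to time n has a
probability that does not depend on n, and it decreases with n: up to a null set it does
not depend on n. As it is determined by the past, it is independent of the arrivals from
time 0 on; but these may form an erasing word adapted to the bound on the past, which
forces a coalescence. So this event is null ([ae_coalesces]).

Conclusion. At a coalescence time all systems started early enough, from bounded
contents, are empty. From an empty time on, the matching does not depend on what happened
before ([matching_restart]), so the matchings started at even times converge to the one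
induced by the common value [Wstar] of the buffers; the odd starting times are the even
ones of the shifted input, which gives [Wsstar]. A sequence of starting times visits one
parity infinitely often, so there is no other limit. The two limits differ: at an even
construction point no edge of the first matching crosses this time, while the buffer of
the second system has odd size there, so that some edge of the second one does
([induced_neq]). Finally a stationary solution is tight, hence bounded at remote times
with high probability, and is caught by the coupling ([stationary_unique]). *)

Set Implicit Arguments.
Unset Strict Implicit.
Unset Printing Implicit Defensive.

Import Order.TTheory GRing.Theory Num.Theory.

Local Open Scope classical_set_scope.
Local Open Scope ring_scope.

(** * Shifts of the input *)

Section shift.
Variable G : sgraph.
Implicit Types w : Omega G.

Lemma thetaE m w n : theta m w n = w (n + m).
Proof. by []. Qed.

Lemma theta_comp m n w : theta m (theta n w) = theta (m + n) w.
Proof. by apply/funext => k; rewrite !thetaE addrA. Qed.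

Lemma theta0 w : theta 0 w = w.
Proof. by apply/funext => k; rewrite thetaE addr0. Qed.

End shift.

(** * Contents of the buffer *)

Section trajectories.
Variables (R : realType) (G : sgraph) (phi : policy R G).
Implicit Types (w : Omega G) (y z : seq G) (s t u : int).

Lemma odot_nil a : odot phi [::] a = [:: a.1].
Proof. by []. Qed.

Lemma size_delete_at (T : Type) p (x : seq T) :
  (p < size x)%N -> size (delete_at p x) = (size x).-1.
Proof. by move=> px; rewrite size_cat size_take size_drop px; lia. Qed.

Lemma size_odot x a : inW x ->
  size (odot phi x a) = if has (edge a.1) x then (size x).-1 else (size x).+1.
Proof.
move=> xW; rewrite /odot; case: ifP => h; last by rewrite size_rcons.
by rewrite size_delete_at//; case: (mposP phi xW h).
Qed.

Lemma odd_size_odot x a : inW x -> odd (size (odot phi x a)) = ~~ odd (size x).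
Proof.
move=> xW; rewrite size_odot//; case: ifP => // h.
by have [+ _] := mposP phi xW h; case: (size x) => //= n _; rewrite negbK.
Qed.

Lemma inW_nil : inW ([::] : seq G).
Proof. by []. Qed.

Lemma inW2_nil : inW2 ([::] : seq G).
Proof. by []. Qed.

Lemma inW_traj w s y n : inW y -> inW (traj phi w s y n).
Proof. by move=> yW; elim: n => //= n; apply: inW_odot. Qed.

Lemma odd_size_traj w s y n : inW y ->
  odd (size (traj phi w s y n)) = odd n (+) odd (size y).
Proof.
move=> yW; elim: n => //= n IHn; rewrite odd_size_odot ?IHn ?addNb//.
exact: inW_traj.
Qed.

Lemma traj_add w s y m n :
  traj phi w s y (m + n) = traj phi w (s + m%:Z) (traj phi w s y m) n.
Proof.
elim: n => [|n IHn]; first by rewrite addn0.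
by rewrite addnS /= IHn; congr (odot _ _ (w _)); lia.
Qed.

Lemma traj_theta w k s y n :
  traj phi (theta k w) s y n = traj phi w (s + k) y n.
Proof. by elim: n => //= n ->; rewrite thetaE; congr (odot _ _ (w _)); lia. Qed.

(** Content at time t of the system started from y at time s; meaningful for s <= t, the
two times being integers. *)
Definition buf w s y t := traj phi w s y (absz (t - s)%R).

Lemma bufxx w s y : buf w s y s = y.
Proof. by rewrite /buf subrr. Qed.

Lemma buf_traj w s y n : buf w s y (s + n%:Z) = traj phi w s y n.
Proof. by rewrite /buf; congr traj; lia. Qed.

Lemma buf_step w s y t : s <= t -> buf w s y (t + 1) = odot phi (buf w s y t) (w t).
Proof.
move=> st; rewrite /buf; have -> : (absz (t + 1 - s)%R) = (absz (t - s)%R).+1 by lia.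
by rewrite /=; congr (odot _ _ (w _)); lia.
Qed.

Lemma buf_cat w s y t u : s <= t -> t <= u ->
  buf w s y u = buf w t (buf w s y t) u.
Proof.
move=> st tu; rewrite /buf;
  have -> : (absz (u - s)%R) = ((absz (t - s)%R) + (absz (u - t)%R))%N by lia.
by rewrite traj_add; congr traj; lia.
Qed.

Lemma inW_buf w s y t : inW y -> inW (buf w s y t).
Proof. exact: inW_traj. Qed.

Lemma buf_theta w k s y t :
  buf (theta k w) s y t = buf w (s + k) y (t + k).
Proof. by rewrite /buf traj_theta; congr traj; lia. Qed.

Lemma inW2_buf w s y t : inW2 y -> inW2 (buf w (2 * s) y (2 * t)).
Proof.
move=> [yW ye]; split; first exact: inW_buf.
rewrite odd_size_traj// (negbTE ye) addbF.
have -> : (absz (2 * t - 2 * s)%R) = (2 * (absz (t - s)%R))%N.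
  lia.
by rewrite oddM.
Qed.

End trajectories.

(** * Matchings and stored items *)

Section matchings.
Variables (R : realType) (G : sgraph) (phi : policy R G).
Implicit Types (w : Omega G) (y z : seq G) (s t u : int) (x : item).

Lemma ltraj_restart w s y m n : traj phi w s y m = [::] ->
  ltraj phi w s y (m + n) = ltraj phi w (s + m%:Z) [::] n.
Proof.
move=> h; elim: n => [|n IHn].
  by rewrite addn0 /=; move: h; rewrite -unzip2_ltraj; case: ltraj.
rewrite addnS /= IHn; have -> : s + (m + n)%N%:Z = s + m%:Z + n%:Z by lia.
by [].
Qed.

Lemma matched_restart w s y m n x : traj phi w s y m = [::] ->
  matched_on_arrival phi w s y (m + n) x =
  matched_on_arrival phi w (s + m%:Z) [::] n x.
Proof.
move=> h; rewrite /matched_on_arrival ltraj_restart//.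
by have -> : s + (m + n)%N%:Z = s + m%:Z + n%:Z by lia.
Qed.

(** Once the buffer is empty, the earlier arrivals have left: the labelled buffer, hence
the matching of the later arrivals, is that of a system started empty. *)
Lemma matching_restart w s y t i j : s <= t -> buf phi w s y t = [::] ->
  t <= i -> t <= j ->
  matching_from phi w s y (inr i) (inr j) <->
  matching_from phi w t [::] (inr i) (inr j).
Proof.
move=> st h ti tj.
have et : t = s + (absz (t - s)%R)%:Z by lia.
split=> -[n [[e M]|[e M]]].
- exists (n - (absz (t - s)%R))%N; left; move: e => [e].
  have en : n = ((absz (t - s)%R) + (n - (absz (t - s)%R)))%N by lia.
  split; first by congr inr; lia.
  by move: M; rewrite {1}en matched_restart// -et.
- exists (n - (absz (t - s)%R))%N; right; move: e => [e].
  have en : n = ((absz (t - s)%R) + (n - (absz (t - s)%R)))%N by lia.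
  split; first by congr inr; lia.
  by move: M; rewrite {1}en matched_restart// -et.
- exists ((absz (t - s)%R) + n)%N; left; move: e => [e].
  split; first by congr inr; lia.
  by rewrite matched_restart// -et.
- exists ((absz (t - s)%R) + n)%N; right; move: e => [e].
  split; first by congr inr; lia.
  by rewrite matched_restart// -et.
Qed.

Definition shift_item k x : item := if x is inr i then inr (i + k) else x.

Lemma shift_item_inj k : injective (shift_item k).
Proof. by move=> [i|i] [j|j] //= [] /addIr->. Qed.

Lemma ltraj_theta w k s y n :
  ltraj phi w (s + k) y n =
  [seq (shift_item k p.1, p.2) | p <- ltraj phi (theta k w) s y n].
Proof.
elim: n => [|n IHn] /=.
  by elim: y (iota 0 _) => [|a y IHy] [|b l] //=; rewrite -IHy.
rewrite IHn thetaE; have -> : s + k + n%:Z = s + n%:Z + k by lia.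
set f := (fun p => _).
have -> b : unzip2 [seq f p | p <- b] = unzip2 b by rewrite /unzip2 -map_comp.
case: ifP => _; first by rewrite /delete_at map_cat map_take map_drop.
by rewrite map_rcons.
Qed.

Lemma matched_theta w k s y n x :
  matched_on_arrival phi (theta k w) s y n x <->
  matched_on_arrival phi w (s + k) y n (shift_item k x).
Proof.
rewrite /matched_on_arrival ltraj_theta thetaE.
have -> : s + k + n%:Z = s + n%:Z + k by lia.
set f := (fun p => _).
have -> b : unzip2 [seq f p | p <- b] = unzip2 b by rewrite /unzip2 -map_comp.
set b := ltraj _ _ _ _ _; set a := w _; set p := mpos _ _ _.
have -> : nth (inr (s + n%:Z + k), a.1) [seq f p | p <- b] p =
    f (nth (inr (s + n%:Z), a.1) b p).
  have [pb|pb] := ltnP p (size b); first by rewrite (nth_map (inr (s + n%:Z), a.1)).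
  by rewrite !nth_default// size_map.
split=> -[h e]; split => //; first by rewrite e.
exact: shift_item_inj e.
Qed.

Lemma matching_theta w k s y x x' :
  matching_from phi (theta k w) s y x x' <->
  matching_from phi w (s + k) y (shift_item k x) (shift_item k x').
Proof.
have e n : s + k + n%:Z = s + n%:Z + k by lia.
split=> -[n [[E M]|[E M]]]; exists n; [left|right|left|right]; split.
- by rewrite E /= e.
- exact/matched_theta.
- by rewrite E /= e.
- exact/matched_theta.
- by apply: (@shift_item_inj k); rewrite E /= e.
- exact/matched_theta.
- by apply: (@shift_item_inj k); rewrite E /= e.
- exact/matched_theta.
Qed.

Lemma mpos_lt w s y n : inW y ->
  let b := ltraj phi w s y n in let a := w (s + n%:Z) in
  has (edge a.1) (unzip2 b) -> (mpos phi (unzip2 b) a < size b)%N.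
Proof.
move=> yW /= h; rewrite -(size_map snd).
suff bW : inW (unzip2 (ltraj phi w s y n)) by case: (mposP phi bW h).
by rewrite unzip2_ltraj; exact: inW_traj.
Qed.

Definition labels w s n : seq item := unzip1 (ltraj phi w s [::] n).

Lemma labels_step w s n :
  let b := ltraj phi w s [::] n in let a := w (s + n%:Z) in
  labels w s n.+1 = if has (edge a.1) (unzip2 b)
    then delete_at (mpos phi (unzip2 b) a) (labels w s n)
    else rcons (labels w s n) (inr (s + n%:Z)).
Proof.
rewrite /labels /=; case: ifP => _; last by rewrite /unzip1 map_rcons.
by rewrite /delete_at /unzip1 map_cat map_take map_drop.
Qed.

Lemma mem_delete_at (T : eqType) p (b : seq T) (x : T) : x \in delete_at p b -> x \in b.
Proof. by rewrite mem_cat => /orP[/mem_take|/mem_drop]. Qed.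

Lemma labels_range w s n x : x \in labels w s n ->
  exists2 i, x = inr i & s <= i < s + n%:Z.
Proof.
elim: n => // n IHn; rewrite labels_step; case: ifP => _.
  by move=> /mem_delete_at/IHn[i -> ri]; exists i => //; lia.
rewrite mem_rcons inE => /orP[/eqP->|/IHn[i -> ri]]; last by exists i => //; lia.
by exists (s + n%:Z) => //; lia.
Qed.

(** A label enters the buffer only at the time it names, later than all labels present. *)
Lemma labels_uniq w s n : uniq (labels w s n).
Proof.
elim: n => // n IHn; rewrite labels_step; case: ifP => _.
  set p := mpos _ _ _; rewrite /delete_at.
  move: IHn; rewrite -{1}(cat_take_drop p (labels w s n)).
  rewrite -[p.+1]add1n -drop_drop => h.
  by apply: subseq_uniq h; rewrite cat_subseq ?drop_subseq.
rewrite rcons_uniq IHn andbT; apply/negP => /labels_range[i [<-]]; lia.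
Qed.

Lemma labels_old w s m n i : (m <= n)%N -> i < s + m%:Z ->
  inr i \in labels w s n -> inr i \in labels w s m.
Proof.
elim: n => [|n IHn]; first by rewrite leqn0 => /eqP->.
rewrite leq_eqVlt => /orP[/eqP->//|mn] im; rewrite labels_step; case: ifP => _.
  by move=> /mem_delete_at; exact: IHn.
rewrite mem_rcons inE => /orP[/eqP[e]|]; last exact: IHn.
by lia.
Qed.

Lemma matched_mem w s n x : matched_on_arrival phi w s [::] n x ->
  x \in labels w s n /\ x \notin labels w s n.+1.
Proof.
move=> [h ->]; have plt := mpos_lt (@inW_nil G) h; move: (labels_uniq w s n).
rewrite labels_step h /labels; set b := ltraj _ _ _ _ _ in plt *.
set p := mpos _ _ _ in plt *; set x0 := (inr _, _).
rewrite -(nth_map x0 x0.1)// -/(unzip1 b).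
have plt' : (p < size (unzip1 b))%N by rewrite size_map.
rewrite -{1}(cat_take_drop p (unzip1 b)) (drop_nth x0.1)// cat_uniq /=.
move=> /and3P[_ hp /andP[hp' _]]; split; first exact: mem_nth.
rewrite /delete_at mem_cat negb_or hp' andbT.
by move: hp; rewrite negb_or => /andP[].
Qed.

Lemma matched_not_stored w s n n' x : matched_on_arrival phi w s [::] n x ->
  inr (s + n%:Z) \notin labels w s n'.
Proof.
move=> [h _]; apply/negP => hn'; have [n'n|nn'] := leqP n' n.
  by have [i [<-]] := labels_range hn'; lia.
have : inr (s + n%:Z) \in labels w s n.+1 by apply: labels_old hn' => //; lia.
by rewrite labels_step h => /mem_delete_at/labels_range[i [<-]]; lia.
Qed.

Lemma matched_inj w s n n' x : matched_on_arrival phi w s [::] n x ->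
  matched_on_arrival phi w s [::] n' x -> n = n'.
Proof.
wlog nn' : n n' / (n <= n')%N => [H h h'|].
  by have [/H->//|/ltnW/H->] := leqP n n'.
move=> /matched_mem[xn xn1] /matched_mem[xn' _].
apply/eqP; rewrite eqn_leq nn' /= leqNgt; apply/negP => lt.
have [i ei ri] := labels_range xn; subst x.
by move: xn1; rewrite (labels_old lt _ xn')//; lia.
Qed.

Lemma removed_matched w s n n' x : (n <= n')%N -> x \in labels w s n ->
  x \notin labels w s n' ->
  exists2 l, (n <= l < n')%N & matched_on_arrival phi w s [::] l x.
Proof.
move=> + xn; elim: n' => [|n' IHn].
  by rewrite leqn0 => /eqP n0; move: xn; rewrite n0 => ->.
rewrite leq_eqVlt => /orP[/eqP<-|nn']; first by rewrite xn.
have [xn'|/IHn[//|l ll M _]] := boolP (x \in labels w s n'); last by exists l => //; lia.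
rewrite labels_step; case: ifP => [h|]; last by rewrite mem_rcons inE xn' orbT.
have plt := mpos_lt (@inW_nil G) h; move: xn'.
rewrite /labels; set b := ltraj _ _ _ _ _ in plt *; set p := mpos _ _ _ in plt *.
set x0 : item * G := (inr (s + n'%:Z), (w (s + n'%:Z)).1).
have plt' : (p < size (unzip1 b))%N by rewrite size_map.
rewrite -{1}(cat_take_drop p (unzip1 b)) (drop_nth x0.1)// /delete_at !mem_cat inE.
move=> /or3P[->//|/eqP ex|->]; last by rewrite orbT.
move=> _; exists n'; first by lia.
by split => //; rewrite ex (nth_map x0).
Qed.

End matchings.

(** * Matchings induced by a bi-infinite buffer *)

Section blocks.
Variables (R : realType) (G : sgraph) (phi : policy R G).
Implicit Types (w : Omega G) (y z : seq G) (s t u : int) (x : item).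

Lemma matching_sym w s y x x' :
  matching_from phi w s y x x' -> matching_from phi w s y x' x.
Proof. by move=> [n [|] M]; exists n; [right|left]. Qed.

Lemma matching_lt w s i j : matching_from phi w s [::] (inr i) (inr j) -> i < j ->
  exists2 n : nat, j = s + n%:Z & matched_on_arrival phi w s [::] n (inr i).
Proof.
move=> [n [[[ej] M]|[[ei] M]]] ij; first by exists n.
have [/labels_range[k [<-]]] := matched_mem M; lia.
Qed.

Lemma matching_neq w s i : ~ matching_from phi w s [::] (inr i) (inr i).
Proof.
by move=> [n [[[ei] M]|[[ei] M]]]; have [/labels_range[k [<-]]] := matched_mem M; lia.
Qed.

(** An item is matched at most once: either on arrival, with the item at the position
selected by the policy, and then it is never stored; or later, when it leaves the buffer. *)
Lemma matching_unique w s i j j' : matching_from phi w s [::] (inr i) (inr j) ->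
  matching_from phi w s [::] (inr i) (inr j') -> j = j'.
Proof.
have aux k l l' : matching_from phi w s [::] (inr k) (inr l) ->
    matching_from phi w s [::] (inr k) (inr l') -> k < l -> l = l'.
  move=> M M' kl; have [n ln mn] := matching_lt M kl.
  have [kl'|l'k|kl'] := ltgtP k l'; last by subst; case: (matching_neq M').
    by have [n' -> mn'] := matching_lt M' kl'; rewrite ln (matched_inj mn mn').
  have [n' kn' mn'] := matching_lt (matching_sym M') l'k.
  have [+ _] := matched_mem mn; rewrite {1}kn' => h.
  by case/negP: (matched_not_stored n mn').
move=> M M'; have [ij|ji|ij] := ltgtP i j; last by subst; case: (matching_neq M).
  exact: aux M M' ij.
have [ij'|j'i|ij'] := ltgtP i j'; last by subst; case: (matching_neq M').
  by apply/esym; exact: aux M' M ij'.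
have [n ein [h ej]] := matching_lt (matching_sym M) ji.
have [n' ein' [h' ej']] := matching_lt (matching_sym M') j'i.
have nn' : n = n' by lia.
by subst n'; move: ej'; rewrite -ej => -[].
Qed.

Variables (w : Omega G) (U : int -> Omega G -> seq G).
Hypothesis U_step : forall n : int, U (n + 1) w = odot phi (U n w) (w n).
Hypothesis U_past : forall n : int, exists2 t, t <= n & U t w = [::].
Hypothesis U_fut : forall n : int, exists2 t, n < t & U t w = [::].

Lemma recursion_buf s t : s <= t -> U t w = buf phi w s (U s w) t.
Proof.
move=> st; have -> : t = s + (absz (t - s)%R)%:Z by lia.
rewrite buf_traj; elim: (absz _) => [|n IHn]; first by rewrite addr0.
by rewrite /= -IHn -U_step; congr U; lia.
Qed.

Lemma recursion_traj s n : U s w = [::] -> U (s + n%:Z) w = traj phi w s [::] n.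
Proof. by move=> h; rewrite (@recursion_buf s) ?buf_traj ?h//; lia. Qed.

Lemma block_exists i :
  exists s t, consecutive_points (U^~ w) s t /\ s <= i < t.
Proof.
(* The least distances from i to construction points on each side delimit its block. *)
have [exs ext] : (exists n : nat, U (i - n%:Z) w == [::]) /\
    (exists n : nat, U (i + n.+1%:Z) w == [::]).
  split.
    have [t ti Ut] := U_past i; exists (absz (i - t)%R); apply/eqP.
    by rewrite -Ut; congr U; lia.
  have [t ti Ut] := U_fut i; exists (absz (t - i - 1)%R); apply/eqP.
  by rewrite -Ut; congr U; lia.
case: (ex_minnP exs) => m /eqP Um minm; case: (ex_minnP ext) => n /eqP Un minn.
exists (i - m%:Z), (i + n.+1%:Z); split; last by lia.
split => // [|u ru Uu]; first by lia.
have [ui|iu] := leP u i.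
  have := minm (absz (i - u)%R); have -> : i - (absz (i - u)%R)%:Z = u by lia.
  by rewrite Uu => /(_ (eqxx _)); lia.
have := minn (absz (u - i - 1)%R).
have -> : i + (absz (u - i - 1)%R).+1%:Z = u by lia.
by rewrite Uu => /(_ (eqxx _)); lia.
Qed.

Lemma point_le_block t0 s t i : U t0 w = [::] -> consecutive_points (U^~ w) s t ->
  t0 <= i -> s <= i < t -> t0 <= s.
Proof.
move=> U0 [_ _ _ ne] t0i sit; rewrite leNgt; apply/negP => st0.
by apply: (ne t0) => //; lia.
Qed.

Lemma matching_point_lt t0 i j : U t0 w = [::] -> i < j ->
  matching_from phi w t0 [::] (inr i) (inr j) -> induced_matching phi U w i j.
Proof.
move=> U0 ij M; have [n jn mn] := matching_lt M ij.
have [s [t [cst sjt]]] := block_exists j; exists s, t.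
have t0s : t0 <= s by apply: (point_le_block U0 cst _ sjt); lia.
have Us : buf phi w t0 [::] s = [::] by rewrite -{1}U0 -recursion_buf//; case: cst.
have si : s <= i.
  have en : n = (absz (s - t0)%R + (n - absz (s - t0)%R))%N by lia.
  move: mn; rewrite {1}en matched_restart//.
  have -> : t0 + (absz (s - t0)%R)%:Z = s by lia.
  by move=> /matched_mem[/labels_range[k [<-]]]; lia.
split => //; first by lia.
by apply/(matching_restart t0s Us) => //; lia.
Qed.

Lemma induced_sym i j : induced_matching phi U w i j -> induced_matching phi U w j i.
Proof. by move=> [s [t [c ri rj M]]]; exists s, t; split => //; exact: matching_sym. Qed.

(** Starting at a construction point or at the beginning of the block makes no difference,
and an item cannot be matched with one of a previous block, which has left. *)
Lemma matching_point t0 i j : U t0 w = [::] -> t0 <= i -> t0 <= j ->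
  matching_from phi w t0 [::] (inr i) (inr j) <-> induced_matching phi U w i j.
Proof.
move=> U0 t0i t0j; split=> [M|[s [t [cst ri rj M]]]].
  have [ij|ji|ij] := ltgtP i j; last by subst; case: (matching_neq M).
    exact: matching_point_lt M.
  by apply: induced_sym; apply: matching_point_lt (matching_sym M).
have t0s : t0 <= s by apply: (point_le_block U0 cst _ ri).
have Us : buf phi w t0 [::] s = [::] by rewrite -{1}U0 -recursion_buf//; case: cst.
by apply/(matching_restart t0s Us) => //; lia.
Qed.

(** The buffer is empty at the end of the block, so what it holds in between is matched
before this end. *)
Lemma stored_matched s t i u : consecutive_points (U^~ w) s t -> s <= u <= t ->
  inr i \in labels phi w s (absz (u - s)%R) ->
  exists2 j, u <= j < t & induced_matching phi U w i j.
Proof.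
move=> cst sut iu; have [st Us Ut _] := cst.
have it : inr i \notin labels phi w s (absz (t - s)%R).
  have : traj phi w s [::] (absz (t - s)%R) = [::].
    by rewrite -recursion_traj// -Ut; congr U; lia.
  by rewrite /labels -unzip2_ltraj; case: ltraj.
have [|l ll M] := removed_matched _ iu it; first by lia.
have [/labels_range[k [ki] rk] _] := matched_mem M; subst k.
exists (s + l%:Z); first by lia.
exists s, t; split => //; [lia|lia|].
by exists l; left.
Qed.

Lemma induced_perfect : perfect (induced_matching phi U w).
Proof.
move=> i; have [s [t [cst sit]]] := block_exists i.
have ex : exists j, induced_matching phi U w i j.
  have [il|iNl] := boolP (inr i \in labels phi w s (absz (i - s)%R).+1).
    have [||j _ Mj] := @stored_matched s t i (i + 1) cst; [lia| |by exists j].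
    by have -> : absz (i + 1 - s)%R = (absz (i - s)%R).+1 by lia.
  move: iNl; rewrite labels_step; case: ifP => [h _|_]; last first.
    by rewrite mem_rcons inE negb_or => /andP[/eqP[]]; congr inr; lia.
  set n := absz _ in h.
  pose x := (nth (inr (s + n%:Z), (w (s + n%:Z)).1) (ltraj phi w s [::] n)
    (mpos phi (unzip2 (ltraj phi w s [::] n)) (w (s + n%:Z)))).1.
  have M : matched_on_arrival phi w s [::] n x by split.
  have [/labels_range[k ex rk] _] := matched_mem M.
  exists k, s, t; split => //; first by lia.
  by exists n; right; rewrite -ex; split => //; congr inr; lia.
have [j Mj] := ex; exists j; split => // j'.
move: Mj => [s1 [t1 [c1 r1 q1 M1]]] [s2 [t2 [c2 r2 q2 M2]]].
have s12 : s1 = s2.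
  apply/eqP; rewrite eq_le; apply/andP; split.
    by apply: (point_le_block _ c2 _ r2); [case: c1|lia].
  by apply: (point_le_block _ c1 _ r1); [case: c2|lia].
by subst s2; exact: matching_unique M1 M2.
Qed.

End blocks.

Section two_matchings.
Variables (R : realType) (G : sgraph) (phi : policy R G) (w : Omega G).

(** No edge of the first matching crosses its construction point t, while the items that
the second buffer holds at time t are matched across t. *)
Lemma induced_neq (U U' : int -> Omega G -> seq G) t :
  (forall n : int, U' (n + 1) w = odot phi (U' n w) (w n)) ->
  (forall n : int, exists2 t, t <= n & U' t w = [::]) ->
  (forall n : int, exists2 t, n < t & U' t w = [::]) ->
  U t w = [::] -> U' t w <> [::] ->
  induced_matching phi U w <> induced_matching phi U' w.
Proof.
move=> st pa fu Ut U't eU; have [s' [t' [c' r']]] := block_exists pa fu t.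
have [s't' Us' _ _] := c'.
have s't : s' < t.
  rewrite lt_neqAle; apply/andP; split; last by lia.
  by apply/eqP => e; apply: U't; rewrite -e.
have : traj phi w s' [::] (absz (t - s')%R) <> [::].
  by rewrite -(recursion_traj st)//; have -> : s' + (absz (t - s')%R)%:Z = t by lia.
rewrite -unzip2_ltraj => ne.
have [x xl] : exists x, x \in labels phi w s' (absz (t - s')%R).
  by rewrite /labels; case: ltraj ne => // -[x a] b _; exists x; rewrite inE eqxx.
have [i ei ri] := labels_range xl; subst x.
have [||j rj] := @stored_matched _ _ phi w U' st s' t' i t c'; [lia|by []|].
rewrite -eU => -[s1 [t1 [[_ _ _ ne1] r1 q1 _]]].
by apply: (ne1 t) => //; lia.
Qed.

End two_matchings.

(** * Walks and bipartitions *)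

Section walks.
Variable G : sgraph.

Fixpoint walk (n : nat) (i j : G) : Prop :=
  if n is n'.+1 then exists2 k, edge i k & walk n' k j else i = j.

Lemma walk_cat m n i j k : walk m i j -> walk n j k -> walk (m + n) i k.
Proof.
elim: m i => [|m IHm] i /=; first by move=> ->.
by move=> [l il lj] jk; exists l => //; exact: IHm lj jk.
Qed.

Lemma walk1 i j : edge i j -> walk 1 i j.
Proof. by move=> ij; exists j. Qed.

Lemma walk_sym n i j : walk n i j -> walk n j i.
Proof.
elim: n i => [|n IHn] i //= [k ik kj].
have := walk_cat (IHn _ kj) (walk1 (_ : edge k i)).
by rewrite addn1; apply; rewrite edge_sym.
Qed.

Lemma walk_rcons n i j : walk n.+1 i j -> exists2 k, walk n i k & edge k j.
Proof.
move=> /walk_sym[k jk ki]; exists k; first exact: walk_sym.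
by rewrite edge_sym.
Qed.

Lemma walk_exists i j : exists n, walk n i j.
Proof.
have /connectP[p + ->] := edge_conn i j.
elim: p i => [|k p IHp] i /=; first by exists 0%N.
by move=> /andP[ik /IHp[n kn]]; exists n.+1, k.
Qed.

(** A vertex reached from i by walks of both parities would give a closed odd walk at i,
and so an odd walk from i to j. Hence the parity of the walks from i is well defined. *)
Lemma bipartition_of_no_odd_walk i j :
  (forall n, odd n -> ~ walk n i j) ->
  exists side : G -> bool, forall k l, edge k l -> side k = ~~ side l.
Proof.
move=> noodd.
have par k m n : walk m i k -> walk n i k -> odd m = odd n.
  move=> im ni; apply/eqP; apply: contraPT isT => mn _.
  have [l jl] := walk_exists i j; have [ol|el] := boolP (odd l).
    exact: noodd ol jl.
  apply: (noodd (m + n + l)%N); last first.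
    exact: walk_cat (walk_cat im (walk_sym ni)) jl.
  by rewrite !oddD (negbTE el) addbF; move: mn; case: (odd m); case: (odd n).
exists (fun k => `[< exists2 n, ~~ odd n & walk n i k >]) => k l kl.
have [m im] := walk_exists i k.
have il := walk_cat im (walk1 kl); rewrite addn1 in il.
have [om|em] := boolP (odd m); last first.
  rewrite asboolT; last by exists m.
  apply/esym/negP => /asboolP[n en il']; have := par _ _ _ il il'.
  by rewrite /= (negbTE em) (negbTE en).
rewrite [X in ~~ X]asboolT; last by exists m.+1 => //; rewrite /= om.
apply/negP => /asboolP[n en ik]; have := par _ _ _ im ik.
by rewrite om (negbTE en).
Qed.

End walks.

(** * Erasing words *)

Section erasing.
Variables (R : realType) (G : sgraph) (phi : policy R G) (s0 : prefs G).
Implicit Types (i j : G) (y z : seq G).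

(** Only one list of preferences, of positive probability, is needed to build the erasing
words. *)
Definition feed y z : seq G := foldl (fun x v => odot phi x (v, s0)) y z.

Lemma feed_cat y z z' : feed y (z ++ z') = feed (feed y z) z'.
Proof. by rewrite /feed foldl_cat. Qed.

Lemma inW_feed y z : inW y -> inW (feed y z).
Proof. by elim: z y => //= v z IHz y yW; apply: IHz; exact: inW_odot. Qed.

Lemma odd_size_feed y z : inW y -> odd (size (feed y z)) = odd (size z) (+) odd (size y).
Proof.
elim: z y => //= v z IHz y yW; rewrite IHz; last exact: inW_odot.
by rewrite odd_size_odot// addbN addNb.
Qed.

Lemma inW2_feed y z : ~~ odd (size z) -> inW2 y -> inW2 (feed y z).
Proof.
move=> ez [yW ye]; split; first exact: inW_feed.
by rewrite odd_size_feed// (negbTE ez).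
Qed.

Lemma inW_catl y y' : inW (y ++ y') -> inW y.
Proof.
move=> yW i j ij; apply/eqP; rewrite -leqn0 -(yW i j ij) !count_cat.
by rewrite leq_mul ?leq_addr.
Qed.

Lemma inW_edge y i j : inW y -> i \in y -> j \in y -> ~~ edge i j.
Proof.
move=> yW iy jy; apply/negP => /yW/eqP; rewrite muln_eq0 => /orP[]/eqP/count_memPn.
  by rewrite iy.
by rewrite jy.
Qed.

(** The letters of an admissible word do not match each other: a buffer content is the
result of its own arrival, which is how sub-additivity applies to initial contents. *)
Lemma feed_nil y : inW y -> feed [::] y = y.
Proof.
elim/last_ind: y => // y v IHy yW.
rewrite -cats1 feed_cat IHy; last by move: yW; rewrite -cats1; exact: inW_catl.
rewrite /= /odot ifF ?cats1//; apply/negP => /hasP[u uy vu].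
have := inW_edge (i := v) (j := u) yW.
by rewrite !mem_rcons !inE eqxx uy orbT vu => /(_ isT isT).
Qed.

Definition erases z y : Prop :=
  [/\ ~~ odd (size z), feed [::] z = [::] & feed y z = [::]].

Lemma erases_step z z' y : ~~ odd (size z) -> feed [::] z = [::] ->
  erases z' (feed y z) -> erases (z ++ z') y.
Proof.
move=> ez z0 [ez' z0' zy]; split; rewrite ?feed_cat ?z0//.
by rewrite size_cat oddD (negbTE ez).
Qed.

Lemma feed_edge i j : edge i j -> feed [::] [:: i; j] = [::].
Proof.
move=> ij; apply/size0nil; rewrite /= size_odot.
  by rewrite odot_nil /= edge_sym ij.
by apply: inW_odot.
Qed.

Lemma inWP y : (forall k l, k \in y -> l \in y -> ~~ edge k l) -> inW y.
Proof.
move=> ne k l kl; apply/eqP; rewrite muln_eq0; apply: contraT.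
rewrite negb_or -!lt0n -!has_count !has_pred1 => /andP[ky ly].
by move: (ne k l ky ly); rewrite kl.
Qed.

Lemma inW1 i : inW [:: i].
Proof. by apply: inWP => k l; rewrite !inE => /eqP-> /eqP->; rewrite edge_irr. Qed.

Lemma inW_pair i j : ~~ edge i j -> inW [:: i; j].
Proof.
move=> ij; apply: inWP => k l; rewrite !inE => /orP[]/eqP-> /orP[]/eqP->;
  by rewrite ?edge_irr// edge_sym.
Qed.

(** The policy chooses between the two stored letters. *)
Lemma odot_pair i j a : edge a i -> ~~ edge i j ->
  odot phi [:: i; j] (a, s0) = [:: j] \/
  odot phi [:: i; j] (a, s0) = [:: i] /\ edge a j.
Proof.
move=> ai ij; have h : has (edge (a, s0).1) [:: i; j] by rewrite /= ai.
rewrite /odot h; have [] := mposP phi (inW_pair ij) h.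
by case: (mpos _ _ _) => [|[|m]] //= _ aj; [left|right].
Qed.

Lemma odot_single i b : odot phi [:: i] (b, s0) = [::] \/
  odot phi [:: i] (b, s0) = [:: i; b] /\ ~~ edge i b.
Proof.
rewrite /odot; case: ifPn => h.
  by left; have [] := mposP phi (@inW1 i) h; case: (mpos _ _ _).
by right; split => //; move: h; rewrite /= orbF edge_sym.
Qed.

Lemma feed_pair i j a b : edge a i -> ~~ edge i j ->
  [\/ feed [:: i; j] [:: a; b] = [::],
      feed [:: i; j] [:: a; b] = [:: j; b] /\ ~~ edge j b |
      feed [:: i; j] [:: a; b] = [:: i; b] /\ ~~ edge i b /\ edge a j].
Proof.
move=> ai ij; rewrite /feed /=; have [->|[-> aj]] := odot_pair ai ij.
  by have [->|[-> jb]] := odot_single j b; [apply: Or31|apply: Or32].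
by have [->|[-> jb]] := odot_single i b; [apply: Or31|apply: Or33].
Qed.

(** By strong induction on the length of an odd walk i - a - b ... c - e - j. If the
policy matches a with i, the word ab leaves nothing or j and b, joined by a walk shorter
by 2; likewise ec leaves nothing or i and c if e is matched with j. If neither holds, then
a is adjacent to j and e to i, so that ab leaves nothing or i and b, joined by the shorter
walk b ... e - i. *)
Lemma odd_walk_erases n i j : odd n -> walk n i j -> ~~ edge i j ->
  exists z, erases z [:: i; j].
Proof.
elim/ltn_ind: n i j => -[//|[|m]] IH i j; first by move=> _ [k ik <-]; rewrite ik.
rewrite /= negbK => om ij_walk ij; have {}IH := IH m (ltnW (ltnSn _)) _ _ om.
have [a ia [b ab bj]] := ij_walk.
have [e be ej] : exists2 e, walk m.-1 b e & edge e j.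
  by move: bj; rewrite -{1}(prednK (odd_gt0 om)) => /walk_rcons.
have [c ec ci] : exists2 c, edge e c & walk m c i.
  have : walk m.+1 e i.
    rewrite -(prednK (odd_gt0 om)); apply: walk_sym; exists a => //.
    by exists b.
  by [].
have pairE (u v : G) : edge u v -> ~~ odd (size [:: u; v]) /\ feed [::] [:: u; v] = [::].
  by move=> xy; split=> //; exact: feed_edge.
have [ab1 ab2] := pairE _ _ ab; have [ec1 ec2] := pairE _ _ ec.
have ai : edge a i by rewrite edge_sym.
have [h|[h jb]|[h [ib aj]]] := feed_pair b ai ij.
- by exists [:: a; b].
- have [z ez] := IH _ _ (walk_sym bj) jb.
  by exists ([:: a; b] ++ z); apply: erases_step => //; rewrite h.
have [ei|ei] := boolP (edge e i).
  have bi : walk m b i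
    by rewrite -(prednK (odd_gt0 om)) -addn1; exact: walk_cat be (walk1 ei).
  have [z ez] := IH _ _ (walk_sym bi) ib.
  by exists ([:: a; b] ++ z); apply: erases_step => //; rewrite h.
(* As e is not adjacent to i, it can only be matched with j. *)
have ejE : odot phi [:: i; j] (e, s0) = [:: i].
  have h' : has (edge (e, s0).1) [:: i; j] by rewrite /= ej orbT.
  rewrite /odot h'; have [] := mposP phi (inW_pair ij) h'.
  by case: (mpos _ _ _) => [|[|k]] //= _; rewrite (negbTE ei).
have [h'|[h' ic]] := odot_single i c.
  by exists [:: e; c]; split => //; rewrite /feed /= ejE h'.
have [z ez] := IH _ _ (walk_sym ci) ic.
exists ([:: e; c] ++ z); apply: erases_step => //.
by rewrite /feed /= ejE h'.
Qed.

Hypothesis s0_gt0 : 0 < nu phi s0.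
Hypothesis phi_sub : sub_additive phi.
Hypothesis odd_walks : forall i j : G, exists2 n, odd n & walk n i j.

Lemma size_feed_cat z z' :
  (size (feed [::] (z ++ z')) <= size (feed [::] z) + size (feed [::] z'))%N.
Proof.
have WE x : Wphi phi x (nseq (size x) s0) = feed [::] x.
  rewrite /Wphi /feed; elim: x [::] => //= v x IHx y; exact: IHx.
have := phi_sub (size_nseq (size z) s0) (size_nseq (size z') s0).
rewrite !WE; have <- : nseq (size (z ++ z')) s0 = nseq (size z) s0 ++ nseq (size z') s0.
  by rewrite size_cat nseqD.
by rewrite WE; apply; move=> s /nseqP[->].
Qed.

(** Erasing the last two letters ij leaves at most the size of the other ones: by
sub-additivity |W(yijz)| <= |W(y)| + |W(ijz)| = |y|. *)
Lemma erases_word y : inW2 y -> exists z, erases z y.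
Proof.
have [n] := ubnP (size y); elim: n y => // n IH y; rewrite ltnS => yn [yW ye].
case/lastP: y => [|y j] in yn yW ye *; first by exists [::].
case/lastP: y => [|y i] in yn yW ye *; first by rewrite /= in ye.
rewrite -!cats1 -catA /= in yn yW ye *.
have iin : i \in y ++ [:: i; j] by rewrite mem_cat !inE eqxx orbT.
have jin : j \in y ++ [:: i; j] by rewrite mem_cat !inE eqxx !orbT.
have ij := inW_edge yW iin jin.
have [m om mij] := odd_walks i j; have [z [ez z0 zij]] := odd_walk_erases om mij ij.
have [||z' ez'] := IH (feed (y ++ [:: i; j]) z).
- have := size_feed_cat y ([:: i; j] ++ z).
  rewrite catA (feed_cat _ (y ++ _)) (feed_nil yW) (feed_cat _ [:: i; j]).
  rewrite (feed_nil (inW_pair ij)) zij addn0 feed_nil; last exact: inW_catl yW.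
  by move=> /leq_ltn_trans; apply; move: yn; rewrite size_cat /=; lia.
- by apply: inW2_feed.
by exists (z ++ z'); apply: erases_step.
Qed.

(** A content emptied by a first word stays empty after a further erasing word, so the
contents can be erased one after the other. *)
Lemma erases_all (l : seq (seq G)) :
  exists z, ~~ odd (size z) /\ forall y, y \in l -> inW2 y -> feed y z = [::].
Proof.
suff [z [z0 ze zl]] : exists z, [/\ feed [::] z = [::], ~~ odd (size z) &
    forall y, y \in l -> inW2 y -> feed y z = [::]] by exists z.
elim: l => [|y l [z [z0 ez zl]]]; first by exists [::].
have [yW|yW] := pselect (inW2 y); last first.
  exists z; split => // x; rewrite inE => /orP[/eqP->//|]; exact: zl.
have [z' [ez' z0' zy']] := erases_word (inW2_feed ez yW).
exists (z ++ z'); split.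
- by rewrite feed_cat z0.
- by rewrite size_cat oddD (negbTE ez).
move=> x; rewrite inE feed_cat => /orP[/eqP->//|xl xW].
by rewrite zl.
Qed.

End erasing.

(** * Measurable events of the input *)

Section measurability.
Variable G : sgraph.
Implicit Types w : Omega G.

Lemma measurable_exists (T : countType) (Q : T -> Omega G -> Prop) :
  (forall i, measurable [set w | Q i w]) -> measurable [set w | exists i, Q i w].
Proof.
move=> mQ; rewrite (_ : mkset _ = \bigcup_i [set w | Q i w]).
  by apply: countable_bigcupT_measurable => //; exact: countableP.
by apply/seteqP; split=> w /= [i]; [exists i|move=> _; exists i].
Qed.

Lemma measurable_not (Q : Omega G -> Prop) :
  measurable [set w | Q w] -> measurable [set w | ~ Q w].
Proof. by move=> mQ; exact: measurableC. Qed.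

Lemma measurable_forall (T : countType) (Q : T -> Omega G -> Prop) :
  (forall i, measurable [set w | Q i w]) -> measurable [set w | forall i, Q i w].
Proof.
move=> mQ; rewrite (_ : mkset _ = [set w | ~ exists i, ~ Q i w]).
  by apply: measurable_not; apply: measurable_exists => i; exact: measurable_not.
apply/seteqP; split=> w /= => [h [i /(_ (h i))]//|h i].
by apply: contrapT => nQ; apply: h; exists i.
Qed.

Lemma measurable_prop (p : Prop) : measurable [set _ : Omega G | p].
Proof.
have [hp|np] := pselect p.
  by rewrite (_ : mkset _ = setT); [exact: measurableT|apply/seteqP; split].
by rewrite (_ : mkset _ = set0); [exact: measurable0|apply/seteqP; split].
Qed.

Lemma measurable_imply (p : Prop) (Q : Omega G -> Prop) :
  (p -> measurable [set w | Q w]) -> measurable [set w | p -> Q w].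
Proof.
move=> mQ; have [hp|np] := pselect p.
  rewrite (_ : mkset _ = [set w | Q w]); first exact: mQ.
  by apply/seteqP; split=> w /=; [exact|].
rewrite (_ : mkset _ = setT); first exact: measurableT.
by apply/seteqP; split=> w //= _ /np.
Qed.

(** For countable T this is measurability with respect to the discrete sigma-algebra. *)
Definition rv (T : Type) (f : Omega G -> T) :=
  forall u, measurable [set w | f w = u].

Lemma rv_pred (T : countType) (f : Omega G -> T) (Q : T -> Prop) :
  rv f -> measurable [set w | Q (f w)].
Proof.
move=> mf; rewrite (_ : mkset _ = [set w | exists u, Q u /\ f w = u]).
  apply: measurable_exists => u; rewrite (_ : mkset _ = [set w | f w = u] `&` [set w | Q u]).
    by apply: measurableI => //; exact: measurable_prop.
  by apply/seteqP; split=> w /= [].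
by apply/seteqP; split=> w /= => [q|[u [q ->]]//]; exists (f w).
Qed.

Lemma rv_comp2 (T T' : countType) (T'' : Type) (f : Omega G -> T) (g : Omega G -> T')
  (h : T -> T' -> T'') : rv f -> rv g -> rv (fun w => h (f w) (g w)).
Proof.
move=> mf mg u.
rewrite (_ : mkset _ = [set w | exists v, f w = v /\ h v (g w) = u]).
  apply: measurable_exists => v; apply: measurableI; first exact: mf.
  exact: (@rv_pred _ g (fun b => h v b = u) mg).
by apply/seteqP; split=> w /= => [q|[v [-> q]]//]; exists (f w).
Qed.

Lemma rv_coord n : rv (fun w => w n).
Proof. by move=> a; apply: sub_sigma_algebra; exists n, a. Qed.

Lemma rv_traj (R : realType) (phi : policy R G) s y n :
  rv (fun w => traj phi w s y n).
Proof.
elim: n => [|n IHn] /=; last exact: (@rv_comp2 _ (arrival G)) IHn (rv_coord _).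
by move=> u; exact: measurable_prop.
Qed.

Lemma measurable_traj (R : realType) (phi : policy R G) s y n (Q : seq G -> Prop) :
  measurable [set w | Q (traj phi w s y n)].
Proof. exact: (@rv_pred _ _ Q (rv_traj phi s y n)). Qed.

Lemma measurable_theta k (A : set (Omega G)) :
  measurable A -> measurable (theta k @^-1` A).
Proof.
suff h : measurable_fun setT (@theta G k) by move=> /(h measurableT); rewrite setTI.
apply: (@measurability _ _ (Omega G) (Omega G) _ _ (cylinders (G := G))) => //.
move=> _ [B [n [a ->]] <-]; rewrite setTI; exact: rv_coord.
Qed.

Definition cyl (J : seq int) (a : int -> arrival G) : set (Omega G) :=
  [set w | forall n, n \in J -> w n = a n].

Lemma measurable_cyl J a : measurable (cyl J a).
Proof.
apply: measurable_forall => n; apply: measurable_imply => _; exact: rv_coord.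
Qed.

Definition cyls : set (set (Omega G)) :=
  [set A | A = set0 \/ exists J a, uniq J /\ A = cyl J a].

Lemma cylI J a J' a' : cyls (cyl J a `&` cyl J' a').
Proof.
have [comp|/existsNP[n /not_implyP[nJ /not_implyP[nJ' ne]]]] :=
  pselect (forall n, n \in J -> n \in J' -> a n = a' n); last first.
  by left; apply/seteqP; split=> // w [/(_ n nJ) h /(_ n nJ') h']; rewrite h in h'.
right; exists (undup (J ++ J')), (fun n => if n \in J then a n else a' n).
split; first exact: undup_uniq.
apply/seteqP; split=> w /= => [[h h'] n|h]; last split=> n nJ.
- by rewrite mem_undup mem_cat; case: ifP => [nJ _|_ /= nJ']; [exact: h|exact: h'].
- by rewrite h ?nJ// mem_undup mem_cat nJ.
- rewrite h; last by rewrite mem_undup mem_cat nJ orbT.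
  by case: ifP => // nJ'; exact: comp.
Qed.

(** The cylinders over finite sets of times form a pi-system. *)
Lemma measure_ext (R : realType) (m1 m2 : {measure set (Omega G) -> \bar R}) :
  (m1 setT < +oo)%E ->
  (forall J a, uniq J -> m1 (cyl J a) = m2 (cyl J a)) ->
  forall A, measurable A -> m1 A = m2 A.
Proof.
move=> fin eq12; have cT a : cyl [::] a = setT by apply/seteqP; split.
apply: (measure_unique cyls (fun=> setT)) => //.
- apply/seteqP; split; last first.
    apply: smallest_sub; first exact: sigma_algebra_measurable.
    by move=> A [->|[J [a [_ ->]]]]; [exact: measurable0|exact: measurable_cyl].
  apply: smallest_sub; first exact: smallest_sigma_algebra.
  move=> A [n [a ->]]; apply: sub_sigma_algebra; right.
  exists [:: n], (fun=> a); split => //; apply/seteqP; split=> w /= => [h m|h].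
    by rewrite inE => /eqP->.
  by apply: h; rewrite inE.
- move=> A B [->|[J [a [_ ->]]]] [->|[J' [a' [_ ->]]]]; rewrite ?set0I ?setI0; try by left.
  exact: cylI.
- by move=> _; right; exists [::], (point : inputs G); rewrite cT.
- by apply/seteqP; split=> // w _; exists 0%N.
by move=> A [->|[J [a [uJ ->]]]]; [rewrite !measure0|exact: eq12].
Qed.

End measurability.

(** * Stationarity and independence of the input *)

Section product.
Variables (R : realType) (G : sgraph) (phi : policy R G) (mu : G -> R).
Variable P : probability (Omega G) R.
Hypothesis mu_gt0 : forall i, 0 < mu i.
Hypothesis mu_sum1 : \sum_i mu i = 1.
Hypothesis P_prod : product_measure phi P mu.

Let p (a : arrival G) : R := mu a.1 * nu phi a.2.

Lemma p_ge0 a : 0 <= p a.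
Proof. by rewrite mulr_ge0 ?nu_ge0// ltW. Qed.

Lemma p_sum1 : \sum_a p a = 1.
Proof.
rewrite -(pair_bigA _ (fun i s => mu i * nu phi s)) /= -[RHS]mu_sum1.
by apply: eq_bigr => i _; rewrite -mulr_sumr nu_sum1 mulr1.
Qed.

Lemma P_cyl J a : uniq J -> P (cyl J a) = (\prod_(n <- J) p (a n))%:E.
Proof. exact: P_prod. Qed.

Lemma theta_preserving k A : measurable A -> P (theta k @^-1` A) = P A.
Proof.
move=> mA; have mth : measurable_fun setT (@theta G k).
  by move=> _ B mB; rewrite setTI; exact: measurable_theta.
refine (@measure_ext G R (pushforward P (@theta G k)) P _ _ A mA).
  by change (P setT < +oo)%E; rewrite probability_setT ltry.
move=> J a uJ; change (P (theta k @^-1` cyl J a) = P (cyl J a)).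
have -> : theta k @^-1` cyl J a = cyl [seq n + k | n <- J] (fun n => a (n - k)).
  apply/seteqP; split=> w /= h n.
    by move=> /mapP[m mJ ->]; rewrite addrK -h.
  by move=> nJ; rewrite thetaE h ?addrK//; exact: map_f.
rewrite P_cyl ?map_inj_uniq//; last exact: addIr.
by rewrite P_cyl// big_map; congr (_%:E); apply: eq_bigr => n _; rewrite addrK.
Unshelve. exact: mth.
Qed.

(** Both sides, applied to the preimage of a set under the map that resets the coordinates
from t on, are finite measures that agree on cylinders; and an event of the past is its
own preimage. *)
Lemma past_future_indep t E J a : measurable E ->
  (forall w w' : Omega G, (forall n, n < t -> w n = w' n) -> E w -> E w') ->
  uniq J -> (forall n, n \in J -> t <= n) ->
  P (E `&` cyl J a) = (P (cyl J a) * P E)%E.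
Proof.
move=> mE pastE uJ Jt.
(* f forgets the coordinates from t on, so that E is its own preimage. *)
pose f (w : Omega G) : Omega G := fun n => if n < t then w n else (point : inputs G) n.
have mf : measurable_fun setT f.
  apply: (@measurability _ _ (Omega G) (Omega G) _ _ (cylinders (G := G))) => //.
  move=> _ [B [n [b ->]] <-]; rewrite setTI; have [nt|nt] := boolP (n < t).
    rewrite (_ : _ @^-1` _ = [set w | w n = b]); first exact: rv_coord.
    by apply/seteqP; split=> w; rewrite /= /f nt.
  have [e|ne] := pselect ((point : inputs G) n = b).
    rewrite (_ : _ @^-1` _ = setT); first exact: measurableT.
    by apply/seteqP; split=> w //= _; rewrite /f (negbTE nt).
  rewrite (_ : _ @^-1` _ = set0); first exact: measurable0.
  by apply/seteqP; split=> w //=; rewrite /f (negbTE nt).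
have mZ := measurable_cyl J a.
have rge0 : 0 <= \prod_(n <- J) p (a n) by apply: prodr_ge0 => n _; exact: p_ge0.
have fE : f @^-1` E = E.
  apply/seteqP; split=> w /=; apply: pastE => n nt; by rewrite /f nt.
rewrite -{1 2}fE.
have -> : P (cyl J a) = (NngNum rge0)%:num%:E by rewrite P_cyl.
refine (@measure_ext G R (pushforward (mrestr P mZ) f)
  (mscale (NngNum rge0) (pushforward P f)) _ _ E mE).
  change (P (setT `&` cyl J a) < +oo)%E.
  by rewrite setTI P_cyl// ltry.
move=> J' a' uJ'; change (P (f @^-1` cyl J' a' `&` cyl J a) =
  ((NngNum rge0)%:num%:E * P (f @^-1` cyl J' a'))%E).
(* The preimage of a cylinder is a cylinder over the times before t, or is empty. *)
have [comp|/existsNP[n /not_implyP[nJ' /not_implyP[nt ne]]]] :=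
  pselect (forall n, n \in J' -> t <= n -> a' n = (point : inputs G) n); last first.
  have -> : f @^-1` cyl J' a' = set0.
    by apply/seteqP; split=> // w /(_ n nJ'); rewrite /f ltNge nt /= => h; apply: ne.
  by rewrite set0I !measure0 mule0.
pose K := [seq n <- J' | n < t].
have -> : f @^-1` cyl J' a' = cyl K a'.
  apply/seteqP; split=> w h n /=.
    by rewrite mem_filter => /andP[nt /h]; rewrite /f nt.
  move=> nJ'; rewrite /f; case: ltP => nt; first by apply: h; rewrite mem_filter nt.
  by rewrite comp.
have uKJ : uniq (K ++ J).
  rewrite cat_uniq filter_uniq// uJ andbT /=; apply/hasPn => n /Jt tn.
  by rewrite mem_filter ltNge tn.
have -> : cyl K a' `&` cyl J a = cyl (K ++ J) (fun n => if n < t then a' n else a n).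
  apply/seteqP; split=> w /= => [[hK hJ] n|h].
    rewrite mem_cat; case: ltP => nt => [/orP[/hK//|/Jt]|/orP[|/hJ//]].
      by rewrite leNgt nt.
    by rewrite mem_filter ltNge nt.
  split=> n nK; first by rewrite h ?mem_cat ?nK//; move: nK; rewrite mem_filter => /andP[->].
  by rewrite h ?mem_cat ?nK ?orbT// ltNge Jt.
rewrite !P_cyl ?filter_uniq// big_cat /= mulrC EFinM; congr (_%:E * _%:E)%E.
  by apply: eq_big_seq => n /Jt; rewrite leNgt => /negbTE->.
by apply: eq_big_seq => n; rewrite mem_filter => /andP[->].
Unshelve. all: exact: mf.
Qed.

End product.

(** * Tails of the first empty time *)

Section returns.
Variables (R : realType) (G : sgraph) (phi : policy R G) (mu : G -> R).
Variable P : probability (Omega G) R.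
Hypothesis mu_gt0 : forall i, 0 < mu i.
Hypothesis mu_sum1 : \sum_i mu i = 1.
Hypothesis P_prod : product_measure phi P mu.
Hypothesis tau_int : forall Y : Omega G -> seq G, Y2inf Y ->
  P.-integrable setT (tau1 phi Y).
Implicit Types (y : seq G) (w : Omega G).

Let p (a : arrival G) : R := mu a.1 * nu phi a.2.

Definition noreturn k w s y : Prop :=
  forall n, (0 < n <= k)%N -> traj phi w s y (2 * n) <> [::].

Lemma measurable_noreturn k s y : measurable [set w | noreturn k w s y].
Proof.
apply: measurable_forall => n; apply: measurable_imply => _; apply: measurable_not.
exact: (measurable_traj phi s y (2 * n) (fun x => x = [::])).
Qed.

Lemma noreturn_theta k w l s y :
  noreturn k (theta l w) s y <-> noreturn k w (s + l) y.
Proof. by split=> h n /h; rewrite traj_theta. Qed.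

Lemma Y2inf_cst y : inW2 y -> Y2inf (fun _ : Omega G => y).
Proof.
move=> y2; exists (size y).+1 => //; split; last by move=> w; split => //; lia.
by move=> u; exact: measurable_prop.
Qed.

(** [tau1] dominates the number of the events of the series that occur. *)
Lemma sum_tail_fin y : inW2 y ->
  (\sum_(0 <= k <oo) P [set w | noreturn k w 0 y] < +oo)%E.
Proof.
move=> y2; have /integrableP[mtau] := tau_int (Y2inf_cst y2).
apply: le_lt_trans.
have mT k := measurable_noreturn k 0 y.
have -> : (\sum_(0 <= k <oo) P [set w | noreturn k w 0 y] =
    \sum_(0 <= k <oo) \int[P]_(w in setT) (\1_[set w | noreturn k w 0 y] w)%:E)%E.
  by apply: eq_eseriesr => k _; rewrite integral_indic// setIT.
rewrite -integral_nneseries//; last first.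
  by move=> k; apply/measurable_EFinP; exact: measurable_realfun.measurable_indic.
apply: ge0_le_integral => //.
- by move=> w _; apply: nneseries_ge0.
- apply: ge0_emeasurable_sum => // k _.
  by apply/measurable_EFinP; exact: measurable_realfun.measurable_indic.
- exact: measurableT_comp.
move=> w _; apply: le_trans (lee_abs _); apply: le_ereal_inf_tmp => _ [n [n0 nret] <-].
apply: lime_le; first by apply: is_cvg_nneseries => k _ _; rewrite lee_fin.
apply: nearW => N; apply: (@le_trans _ _ (\sum_(0 <= k < N) (k < n)%N%:R%:E)%E).
  apply: lee_sum => k _; rewrite lee_fin indicE.
  case: (boolP (w \in _)) => //; rewrite inE /= => h.
  by case: ltnP => // nk; case: (h n _ nret); rewrite n0.
rewrite sumEFin lee_fin -natr_sum ler_nat.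
elim: N => [|N IHN]; first by rewrite big_nil.
rewrite big_nat_recr//=; have : (\sum_(0 <= k < N) (k < n) <= N)%N.
  rewrite -[X in (_ <= X)%N]subn0 -[X in (_ <= X)%N]muln1 -sum_nat_const_nat.
  by apply: leq_sum => k _; exact: leq_b1.
by case: ltnP => //=; lia.
Qed.

Lemma total_probability (T : finType) (f : Omega G -> T) A : rv f -> measurable A ->
  (P A = \sum_u P (A `&` [set w | f w = u]))%E.
Proof.
move=> mf mA.
rewrite {1}(_ : A = \bigcup_(u in [set` index_enum T]) (A `&` [set w | f w = u])).
  rewrite measure_fin_bigcup//.
  - by rewrite -fsbig_seq ?index_enum_uniq.
  - apply/trivIsetP => u v _ _ /eqP uv.
    by apply/seteqP; split=> // w /= [[_ fu] [_ fv]]; apply: uv; rewrite -fu.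
  - by move=> u _; apply: measurableI.
apply/seteqP; split=> w /=; last by move=> [u _ []].
by move=> Aw; exists (f w) => //=; rewrite mem_index_enum.
Qed.

Definition step2 y (a b : arrival G) : seq G := odot phi (odot phi y a) b.

(** The probability, computed one even step at a time, that the buffer started from y is
not empty at any of the first k even times. *)
Fixpoint survival k y : R :=
  if k is k'.+1 then
    \sum_(ab : arrival G * arrival G) p ab.1 * p ab.2 *
      (if step2 y ab.1 ab.2 == [::] then 0 else survival k' (step2 y ab.1 ab.2))
  else 1.

Lemma noreturnS k w s y : noreturn k.+1 w s y <->
  let y' := step2 y (w s) (w (s + 1)) in y' <> [::] /\ noreturn k w (s + 2) y'.
Proof.
have e : traj phi w s y (2 * 1) = step2 y (w s) (w (s + 1)).
  by rewrite /= addr0.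
split=> [h|[ne h] n /andP[n0 nk]].
  split; first by rewrite -e; exact: h.
  move=> n nk; have := h n.+1; rewrite mulnS traj_add -e; apply; lia.
case: n n0 nk => // -[|n] _ nk; first by rewrite e.
by rewrite mulnS traj_add e; apply: h; lia.
Qed.

Definition window l : seq int := [seq n%:Z | n <- iota 0 l].

Lemma window_uniq l : uniq (window l).
Proof. by rewrite map_inj_uniq ?iota_uniq// => m n []. Qed.

Lemma mem_window l n : (n \in window l) = (0 <= n < l%:Z).
Proof.
apply/mapP/idP => [[m + ->]|nl]; first by rewrite mem_iota; lia.
by exists (absz n); rewrite ?mem_iota; lia.
Qed.

(** The conditioning on a cylinder makes the recursion on the two next arrivals go
through. *)
Lemma P_noreturn_cyl k l a y :
  P (cyl (window l) a `&` [set w | noreturn k w l%:Z y]) =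
  ((\prod_(n <- window l) p (a n)) * survival k y)%:E.
Proof.
elim: k l a y => [|k IHk] l a y.
  rewrite mulr1 -(P_cyl P_prod) ?window_uniq//; congr (P _).
  by apply/seteqP; split=> w /= => [[]//|h]; split => // n; lia.
pose f (w : Omega G) := (w l%:Z, w (l%:Z + 1)).
rewrite (@total_probability (arrival G * arrival G)%type f); last 2 first.
- exact: (@rv_comp2 _ (arrival G) (arrival G)) (rv_coord _) (rv_coord _).
- by apply: measurableI; [exact: measurable_cyl|exact: measurable_noreturn].
rewrite /= mulr_sumr -sumEFin; apply: eq_bigr => -[b c] _ /=.
(* The cylinder a' extends a by the values b and c of the two next arrivals. *)
pose a' n := if n == l%:Z then b else if n == l%:Z + 1 then c else a n.
have eqc : cyl (window l) a `&` [set w | f w = (b, c)] = cyl (window l.+2) a'.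
  apply/seteqP; split=> w /= => [[h [hb hc]] n|h].
    rewrite mem_window /a'; case: eqP => [->//|ne]; case: eqP => [->//|ne'] nl.
    by apply: h; rewrite mem_window; lia.
  split=> [n|]; last first.
    rewrite /f !h ?mem_window /a' ?eqxx//; try by lia.
    by rewrite ifF//; apply/eqP; lia.
  rewrite mem_window => nl; rewrite h ?mem_window /a'; last by lia.
  by rewrite ifF ?ifF//; apply/eqP; lia.
have prodE : \prod_(n <- window l.+2) p (a' n) = (\prod_(n <- window l) p (a n)) * (p b * p c).
  rewrite /window -addn2 iotaD map_cat big_cat /= !big_cons big_nil mulr1.
  rewrite /a' eqxx; congr (_ * (_ * _)).
    rewrite !big_map; apply: eq_big_seq => n; rewrite mem_iota => nl.
    by rewrite ifF ?ifF//; apply/eqP; lia.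
  by rewrite ifF; [rewrite ifT//; apply/eqP; lia|apply/eqP; lia].
case: eqP => [e0|ne].
  rewrite !mulr0 (_ : _ `&` _ = set0) ?measure0//; apply/seteqP; split=> // w /=.
  by move=> [[_ /noreturnS[ne _]] [eb ec]]; apply: ne; rewrite eb ec.
rewrite mulrA -prodE -IHk -eqc; congr (P _).
apply/seteqP; split=> w /=.
  move=> [[h /noreturnS[ne' nr]] fw]; have [eb ec] := fw; split; first by split.
  by move: nr; rewrite eb ec; have -> : l%:Z + 2 = l.+2%:Z by lia.
move=> [[h fw] nr]; have [eb ec] := fw; split => //; split => //; apply/noreturnS.
by rewrite /= eb ec; split => //; have -> : l%:Z + 2 = l.+2%:Z by lia.
Qed.

Lemma P_noreturn k y : P [set w | noreturn k w 0 y] = (survival k y)%:E.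
Proof.
have := P_noreturn_cyl k 0 (point : inputs G) y; rewrite big_nil mul1r => <-.
by congr (P _); apply/seteqP; split=> w //= [].
Qed.

End returns.

(** * Walks of odd length *)

Section parity.
Variables (R : realType) (G : sgraph) (phi : policy R G) (mu : G -> R).
Variable P : probability (Omega G) R.
Hypothesis mu_gt0 : forall i, 0 < mu i.
Hypothesis mu_sum1 : \sum_i mu i = 1.
Hypothesis P_prod : product_measure phi P mu.
Hypothesis tau_int : forall Y : Omega G -> seq G, Y2inf Y ->
  P.-integrable setT (tau1 phi Y).
Implicit Types (y : seq G) (w : Omega G).

Let p (a : arrival G) : R := mu a.1 * nu phi a.2.

Section imbalance.
Variable side : G -> bool.
Hypothesis sideP : forall k l, edge k l -> side k = ~~ side l.

Let d (v : G) : R := if side v then 1 else -1.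

Definition imbalance y : R := \sum_(v <- y) d v.

(** A match removes a letter of the side opposite to that of the arriving item, so it
changes the imbalance exactly as storing this item does. *)
Lemma imbalance_odot y a : inW y ->
  imbalance (odot phi y a) = imbalance y + d a.1.
Proof.
move=> yW; rewrite /odot; case: ifPn => h; last first.
  by rewrite /imbalance -cats1 big_cat big_seq1.
have [plt e] := mposP phi yW h; set q := mpos phi y a in plt e *.
rewrite /delete_at -[in RHS](cat_take_drop q y) (drop_nth a.1 plt) /imbalance.
rewrite !big_cat big_cons /=.
have -> : d a.1 = - d (nth a.1 y q).
  by rewrite /d (sideP e); case: (side _); rewrite /= ?opprK.
ring.
Qed.

Lemma imbalance_le_size y : imbalance y <= (size y)%:R.
Proof.
elim: y => [|v y IHy]; first by rewrite /imbalance big_nil.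
rewrite /imbalance big_cons /= -nat1r lerD// /d; by case: ifP => // _; lra.
Qed.

Let drift : R := \sum_v mu v * d v.
Hypothesis drift_ge0 : 0 <= drift.

Lemma drift_arrival : \sum_a p a * d a.1 = drift.
Proof.
rewrite -(pair_bigA _ (fun i s => mu i * nu phi s * d i)) /=.
apply: eq_bigr => i _; under eq_bigr => s _ do rewrite mulrAC.
by rewrite -mulr_sumr nu_sum1 mulr1.
Qed.

Lemma inW_step2 y a b : inW y -> inW (step2 phi y a b).
Proof. by move=> yW; apply: inW_odot; exact: inW_odot. Qed.

Lemma size_step2 y a b : inW y -> (size (step2 phi y a b) <= (size y).+2)%N.
Proof.
move=> yW; rewrite /step2 size_odot; last exact: inW_odot.
by rewrite size_odot//; do 2 case: ifP => _; lia.
Qed.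

Lemma imbalance_step2 y : inW y ->
  \sum_(ab : arrival G * arrival G) p ab.1 * p ab.2 * imbalance (step2 phi y ab.1 ab.2)
  = imbalance y + 2 * drift.
Proof.
move=> yW.
have E2 a b : imbalance (step2 phi y a b) = imbalance y + d a.1 + d b.1.
  by rewrite /step2 !imbalance_odot//; exact: inW_odot.
under eq_bigr => ab _ do rewrite E2.
rewrite -(pair_bigA _ (fun a b => p a * p b * (imbalance y + d a.1 + d b.1))) /=.
have E a : \sum_b p a * p b * (imbalance y + d a.1 + d b.1) =
    p a * (imbalance y + drift) + p a * d a.1.
  under eq_bigr => b _ do rewrite -mulrA mulrDr.
  rewrite -mulr_sumr big_split /= -mulr_suml drift_arrival (p_sum1 phi mu_sum1).
  ring.
under eq_bigr => a _ do rewrite E.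
rewrite big_split /= -mulr_suml drift_arrival (p_sum1 phi mu_sum1); ring.
Qed.

Lemma survival_ge0 k y : 0 <= survival phi mu k y.
Proof.
elim: k y => //= k IHk y; apply: sumr_ge0 => ab _.
apply: mulr_ge0; last by case: ifP.
by apply: mulr_ge0; exact: p_ge0.
Qed.

(** Optional stopping, by backward induction on the horizon: the imbalance is a
submartingale, it vanishes when the buffer is empty, and otherwise it is at most the size
of the buffer, which grows by at most 2 at each even step. *)
Lemma imbalance_le_survival k y : inW y ->
  imbalance y <= (size y + 2 * k)%:R * survival phi mu k y.
Proof.
elim: k y => [|k IHk] y yW; first by rewrite muln0 addn0 mulr1 imbalance_le_size.
apply: (@le_trans _ _ (imbalance y + 2 * drift)); first by rewrite lerDl mulr_ge0.
rewrite -imbalance_step2// /= mulr_sumr; apply: ler_sum => -[a b] _ /=.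
rewrite [X in _ <= X]mulrCA; apply: ler_wpM2l; first by apply: mulr_ge0; exact: p_ge0.
case: eqP => [->|_]; first by rewrite /imbalance big_nil mulr0.
apply: le_trans (IHk _ _) _; first exact: inW_step2.
rewrite ler_wpM2r ?survival_ge0// ler_nat.
by have := size_step2 a b yW; lia.
Qed.

(** Starting from vv, the bound of [imbalance_le_survival] reads 2 <= (2 + 2k) P(no return),
and the harmonic series contradicts the summability of the tails. *)
Lemma no_positive_side v : ~~ side v.
Proof.
apply/negP => sv.
have vW : inW2 [:: v; v] by split => //; apply: inW_pair; rewrite edge_irr.
have le k : harmonic k <= survival phi mu k [:: v; v].
  have := imbalance_le_survival k (proj1 vW).
  rewrite /imbalance !big_cons big_nil /d sv addr0 /= => h.
  rewrite /harmonic /= -[X in X <= _]mul1r ler_pdivrMr ?ltr0n// mulrC.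
  move: h; have -> : (2 + 2 * k)%:R = 2 * k.+1%:R :> R by rewrite -natrM; congr (_%:R); lia.
  by rewrite -mulrA -[X in X <= _](mulr1 2) ler_pM2l.
apply: (@dvg_harmonic R); apply: nnseries_is_cvg; first by move=> k; exact: harmonic_ge0.
apply: le_lt_trans (sum_tail_fin tau_int vW); apply: lee_nneseries => k _ //.
  by rewrite lee_fin harmonic_ge0.
by rewrite (P_noreturn P_prod) lee_fin.
Qed.

End imbalance.

(** One of the two ways of signing a bipartition has a nonnegative drift, and then it has
no vertex of positive sign; its drift would be -1. *)
Lemma odd_walks (i j : G) : exists2 n, odd n & walk n i j.
Proof.
apply: contrapT => no.
have [|side sideP] := @bipartition_of_no_odd_walk G i j.
  by move=> n on w; apply: no; exists n.
have sideNP k l : edge k l -> ~~ side k = ~~ ~~ side l by move=> /sideP->.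
pose dr (s : G -> bool) : R := \sum_v mu v * (if s v then 1 else -1).
have drN : dr (fun v => ~~ side v) = - dr side.
  rewrite /dr -sumrN; apply: eq_bigr => v _; case: (side v) => /=; ring.
have absurd_side s : (forall k l, edge k l -> s k = ~~ s l) -> 0 <= dr s -> False.
  move=> sP s0; have all v := no_positive_side sP s0 v.
  move: s0; rewrite /dr (eq_bigr (fun v => - mu v)); last first.
    by move=> v _; rewrite (negbTE (all v)) mulrN1.
  by rewrite sumrN mu_sum1; lra.
have [d0|d0] := leP 0 (dr side); first exact: (absurd_side side).
by apply: (absurd_side _ sideNP); rewrite drN; lra.
Qed.

End parity.

(** * Coalescence of the systems started in the past *)

Section coalescence.
Variables (R : realType) (G : sgraph) (phi : policy R G) (mu : G -> R).
Variable P : probability (Omega G) R.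
Hypothesis mu_gt0 : forall i, 0 < mu i.
Hypothesis mu_sum1 : \sum_i mu i = 1.
Hypothesis P_prod : product_measure phi P mu.
Hypothesis phi_sub : sub_additive phi.
Hypothesis tau_int : forall Y : Omega G -> seq G, Y2inf Y ->
  P.-integrable setT (tau1 phi Y).
Implicit Types (y : seq G) (w : Omega G).

Lemma ae_forall (T : countType) (Q : T -> Omega G -> Prop) :
  (forall i, {ae P, forall w, Q i w}) -> {ae P, forall w, forall i, Q i w}.
Proof.
move=> aeQ; pose Q' n w := if unpickle n is Some i then Q i w else True.
have : {ae P, forall w, forall n, Q' n w}.
  apply: ae_foralln => n; rewrite /Q'; case: (unpickle n) => [i|]; first exact: aeQ.
  exact: aeW.
by apply: filterS => w h i; have := h (pickle i); rewrite /Q' pickleK.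
Qed.

Lemma ae_theta k (Q : Omega G -> Prop) :
  {ae P, forall w, Q w} -> {ae P, forall w, Q (theta k w)}.
Proof.
move=> [N [mN N0 QN]]; exists (theta k @^-1` N); split.
- exact: measurable_theta.
- by rewrite (theta_preserving P_prod).
- by move=> w /= nQ; apply: QN.
Qed.

(** Borel-Cantelli: by stationarity the tails are those of a system started at time 0. *)
Lemma ae_returns y (s : nat -> int) : inW2 y ->
  {ae P, forall w, exists K, forall k, (K <= k)%N -> ~ noreturn phi k w (s k) y}.
Proof.
move=> y2; pose F k := [set w | noreturn phi k w (s k) y].
have mF k : measurable (F k) by exact: measurable_noreturn.
have PF k : P (F k) = P [set w | noreturn phi k w 0 y].
  rewrite -(theta_preserving P_prod (s k) (measurable_noreturn phi k 0 y)).
  congr (P _); apply/seteqP; split=> w; rewrite /F /= => h.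
    by apply/noreturn_theta; rewrite add0r.
  by move/noreturn_theta : h; rewrite add0r.
have F0 : P (lim_sup_set F) = 0%E.
  apply: lim_sup_set_cvg0 => //.
  by rewrite (eq_eseriesr (fun k _ => PF k)); exact: sum_tail_fin.
exists (lim_sup_set F); split => //.
  by apply: bigcapT_measurable => n; apply: bigcup_measurable.
move=> w /= nK n _; apply: contrapT => nF; apply: nK; exists n => k nk hk.
by apply: nF; exists k.
Qed.

Definition hits w : Prop := forall y, inW2 y -> forall t : int,
  exists K : int, forall s, s <= K -> exists2 r, s < r <= t & buf phi w (2 * s) y (2 * r) = [::].

Lemma ae_hits : {ae P, forall w, hits w}.
Proof.
apply: (ae_forall (T := seq G)) => y.
have [y2|ny2] := pselect (inW2 y); last by apply: aeW => w /ny2.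
suff : {ae P, forall w, forall t : int, exists K, forall k, (K <= k)%N ->
    ~ noreturn phi k w (2 * t - (2 * k)%N%:Z) y}.
  apply: filterS => w h _ t; have [K hK] := h t.
  exists (t - K%:Z) => s sK; have := hK (absz (t - s)%R).
  move=> /(_ ltac:(lia)); have -> : 2 * t - (2 * absz (t - s)%R)%N%:Z = 2 * s by lia.
  move=> /existsNP[n /not_implyP[nk /contrapT e]]; exists (s + n%:Z); first by lia.
  by rewrite -e -buf_traj; congr buf; lia.
by apply: ae_forall => t; exact: ae_returns.
Qed.

Definition recurs w : Prop := forall t : int,
  exists2 r, t < r & buf phi w (2 * t) [::] (2 * r) = [::].

Lemma ae_recurs : {ae P, forall w, recurs w}.
Proof.
apply: ae_forall => t; have := ae_returns (fun=> 2 * t) (@inW2_nil G).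
apply: filterS => w [K /(_ K (leqnn _))] /existsNP[n /not_implyP[nk /contrapT e]].
exists (t + n%:Z); first by lia.
by apply: etrans e; rewrite -buf_traj; congr buf; lia.
Qed.

(** A system that is empty at time 2r continues as the one started empty at time 2r. So the
value at the deadline is that of one of the finitely many late starts. *)
Lemma hits_bounded w (t : int) : hits w -> exists N : nat, forall s, s <= t ->
  (size (buf phi w (2 * s) [::] (2 * t)) <= N)%N.
Proof.
move=> /(_ [::] (@inW2_nil G) t)[K hK].
pose m := absz (t - K)%R.
pose N := \max_(i < m.+1) size (buf phi w (2 * (t - i%:Z)) [::] (2 * t)).
exists N => s st; have [n] := ubnP (absz (t - s)%R); elim: n s st => // n IH s st sn.
have [sK|Ks] := leP s K; last first.
  have im : (absz (t - s)%R < m.+1)%N by rewrite /m; lia.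
  have -> : s = t - (Ordinal im : nat)%:Z by rewrite /=; lia.
  exact: (leq_bigmax (Ordinal im)).
have [r sr e] := hK s sK.
rewrite (@buf_cat _ _ _ _ _ _ (2 * r)) ?e; [|lia|lia].
by apply: IH; lia.
Qed.

Definition coalesces w (t : int) : Prop :=
  exists2 L, L <= t & forall s, s <= L -> buf phi w (2 * s) [::] (2 * t) = [::].

Lemma traj_local w w' s y n : (forall k, s <= k < s + n%:Z -> w k = w' k) ->
  traj phi w s y n = traj phi w' s y n.
Proof.
elim: n => //= n IH h; rewrite IH ?h//; last by move=> k hk; apply: h; lia.
by lia.
Qed.

Lemma buf_local w w' s y t : s <= t -> (forall k, k < t -> w k = w' k) ->
  buf phi w s y t = buf phi w' s y t.
Proof. by move=> st h; apply: traj_local => k kt; apply: h; lia. Qed.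

Lemma coalesces_theta w k t : coalesces (theta (2 * k) w) t <-> coalesces w (t + k).
Proof.
split=> -[L Lt h].
  exists (L + k) => [|s sL]; first by lia.
  apply: etrans (h (s - k) _); last by lia.
  by rewrite buf_theta; congr buf; lia.
exists (L - k) => [|s sL]; first by lia.
apply: etrans (h (s + k) _); last by lia.
by rewrite buf_theta; congr buf; lia.
Qed.

Lemma measurable_buf s y t (Q : seq G -> Prop) :
  measurable [set w | Q (buf phi w s y t)].
Proof. exact: measurable_traj. Qed.

Lemma measurable_coalesces t : measurable [set w | coalesces w t].
Proof.
rewrite (_ : mkset _ = [set w | exists L, L <= t /\
  forall s, s <= L -> buf phi w (2 * s) [::] (2 * t) = [::]]); last first.
  by apply/seteqP; split=> w [L]; [exists L|move=> [Lt h]; exists L].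
apply: measurable_exists => L; apply: measurableI; first exact: measurable_prop.
apply: measurable_forall => s; apply: measurable_imply => _.
exact: (measurable_buf _ _ _ (fun x => x = [::])).
Qed.

(** A decreasing family of events, with a common probability by stationarity. *)
Let uncoalesced (n : int) : set (Omega G) := [set w | forall t, t <= n -> ~ coalesces w t].

Let measurable_uncoalesced n : measurable (uncoalesced n).
Proof.
apply: measurable_forall => t; apply: measurable_imply => _; apply: measurable_not.
exact: measurable_coalesces.
Qed.

Let P_uncoalesced n : P (uncoalesced n) = P (uncoalesced 0).
Proof.
rewrite -(theta_preserving P_prod (2 * n) (measurable_uncoalesced 0)); congr (P _).
apply/seteqP; split=> w h t tn.
  by move/coalesces_theta; apply: h; lia.
have := h (t - n) ltac:(lia); move=> nc c; apply: nc; apply/coalesces_theta.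
by rewrite subrK.
Qed.

Let P_uncoalescedD n : 0 <= n -> P (uncoalesced 0 `\` uncoalesced n) = 0%E.
Proof.
move=> n0; have AI : uncoalesced 0 `&` uncoalesced n = uncoalesced n.
  by apply/seteqP; split=> w /= => [[]//|h]; split => // t t0; apply: h; lia.
have -> : P (uncoalesced 0 `\` uncoalesced n) =
    (P (uncoalesced 0) - P (uncoalesced 0 `&` uncoalesced n))%E.
  apply: measureD => //.
  by rewrite (le_lt_trans (probability_le1 _ (measurable_uncoalesced 0))) ?ltry.
by rewrite AI P_uncoalesced subee// fin_num_measure.
Qed.

Let past_bounded (r : nat) : set (Omega G) :=
  [set w | forall s, s <= 0 -> (size (buf phi w (2 * s) [::] (2 * 0)) <= r)%N].

Let measurable_bounded r : measurable (past_bounded r).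
Proof.
apply: measurable_forall => s; apply: measurable_imply => _.
exact: (measurable_buf _ _ _ (fun x => (size x <= r)%N)).
Qed.

Lemma pref_exists : exists s0, 0 < nu phi s0.
Proof.
apply: contrapT => no; have : \sum_s nu phi s <= 0.
  by apply: sumr_le0 => s _; rewrite leNgt; apply/negP => h; apply: no; exists s.
by rewrite nu_sum1 ler10.
Qed.

Lemma traj_feed s0 v0 (z y : seq G) w s :
  (forall k, (k < size z)%N -> w (s + k%:Z) = (nth v0 z k, s0)) ->
  traj phi w s y (size z) = feed phi s0 y z.
Proof.
elim: z s y => [//|v z IH] s y h; rewrite -[size _]/(1 + size z)%N traj_add IH.
  by rewrite /= (h 0%N).
by move=> k kz; rewrite -(h k.+1) //; congr (w _); lia.
Qed.

Lemma words_exist (r : nat) : exists l : seq (seq G), forall y, (size y <= r)%N -> y \in l.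
Proof.
exists (flatten [seq [seq (val t : seq G) | t <- enum {: n.-tuple G}] | n <- iota 0 r.+1]).
move=> y yr; apply/flattenP; exists [seq (val t : seq G) | t <- enum {: (size y).-tuple G}].
  by apply/mapP; exists (size y) => //; rewrite mem_iota; lia.
by apply/mapP; exists (in_tuple y); rewrite ?mem_enum.
Qed.

(** On this event of the past, a word that erases all contents bounded by r, arriving from
time 0 on, makes the time of its end a coalescence time. This has probability 0, although
the word has a positive probability and is independent of the past. *)
Let P_uncoalesced_bounded r : P (uncoalesced 0 `&` past_bounded r) = 0%E.
Proof.
have [s0 s0_gt0] := pref_exists; have [l lP] := words_exist r.
have ow := odd_walks mu_gt0 mu_sum1 P_prod tau_int.
have [z [ez zl]] := erases_all s0_gt0 phi_sub ow l.
pose v0 : G := ((point : inputs G) 0).1.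
pose a (n : int) : arrival G := (nth v0 z (absz n), s0).
have sub : (uncoalesced 0 `&` past_bounded r) `&` cyl (window (size z)) a `<=`
    uncoalesced 0 `\` uncoalesced (size z)./2%:Z.
  move=> w [[wA wH] wZ]; split => // /(_ _ (lexx _)); apply.
  exists 0 => // s s_le0; have e2 : 2 * (size z)./2%:Z = (size z)%:Z.
    by have := odd_double_half (size z); rewrite (negbTE ez); lia.
  rewrite e2 (@buf_cat _ _ _ _ _ _ (2 * 0)); [|lia|lia].
  have -> : (size z)%:Z = 2 * 0 + (size z)%:Z by lia.
  rewrite buf_traj (@traj_feed s0 v0); last first.
    move=> k kz; rewrite wZ ?mem_window /a; last by lia.
    by rewrite mulr0 add0r.
  by apply: zl; [apply: lP; exact: wH|exact: inW2_buf].
have : P ((uncoalesced 0 `&` past_bounded r) `&` cyl (window (size z)) a) = 0%E.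
  apply: (subset_measure0 _ _ sub); [|by apply: measurableD|exact: P_uncoalescedD].
  by apply: measurableI; [exact: measurableI|exact: measurable_cyl].
rewrite (@past_future_indep _ _ _ _ _ mu_gt0 P_prod 0)//.
- rewrite (P_cyl P_prod) ?window_uniq//= => /eqP; rewrite mule_eq0 => /orP[|/eqP//].
  rewrite eqe gt_eqF// prodr_gt0// => n _; rewrite mulr_gt0//.
- exact: measurableI.
- move=> w w' ww' [wA wH]; split.
    move=> t t0 [L Lt h]; apply: (wA t t0); exists L => // s sL.
    by rewrite (@buf_local _ w') ?h//; [lia|move=> k kt; apply: ww'; lia].
  by move=> s s_le0; rewrite -(@buf_local w) ?wH//; lia.
- exact: window_uniq.
- by move=> n; rewrite mem_window => /andP[].
Qed.

Let P_uncoalesced0 : P (uncoalesced 0) = 0%E.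
Proof.
have h : P.-negligible (uncoalesced 0).
  have [N [mN N0 hN]] := ae_hits.
  have : P.-negligible (N `|` \bigcup_r (uncoalesced 0 `&` past_bounded r)).
    apply: negligibleU; first by exists N; split.
    apply: negligible_bigcup => r.
    apply/(negligibleP P (measurableI _ _ (measurable_uncoalesced 0) (measurable_bounded r))).
    exact: P_uncoalesced_bounded.
  apply: negligibleS => w wA; have [hw|nhw] := pselect (hits w).
    by right; have [r hr] := hits_bounded 0 hw; exists r.
  by left; exact: hN.
exact/(negligibleP P (measurable_uncoalesced 0)).
Qed.

Lemma ae_coalesces : {ae P, forall w, forall n : int, exists2 t, t <= n & coalesces w t}.
Proof.
apply: ae_forall => n; exists (uncoalesced n); split => //.
  by rewrite P_uncoalesced P_uncoalesced0.
by move=> w /= h t tn c; apply: h; exists t.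
Qed.

End coalescence.

(** * Limits of matchings under coupling *)

Section limits.
Variables (R : realType) (G : sgraph) (phi : policy R G).
Implicit Types (y : seq G) (w : Omega G) (M : zgraph).

(** What the limit theorems use of the buffer U: it is driven by the input, it has
construction points in both directions, and arbitrarily far in the past all systems
started early enough, at times of the parity of p and from contents bounded by r, are
empty together with U. *)
Definition coupled (p : int) (U : int -> Omega G -> seq G) w : Prop :=
  [/\ forall n : int, U (n + 1) w = odot phi (U n w) (w n),
      forall n : int, exists2 t, t <= n & U t w = [::],
      forall n : int, exists2 t, n < t & U t w = [::] &
      forall (r : nat) (n : int), exists t K : int,
        [/\ t <= n, U t w = [::], 2 * K + p <= t & forall s y, s <= K -> inW2r r y ->
            buf phi w (2 * s + p) y t = [::]]].

Lemma coupled_perfect p U w : coupled p U w -> perfect (induced_matching phi U w).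
Proof. by move=> [st pa fu _]; exact: induced_perfect. Qed.

Lemma coupled_limit p U w r (n : int) : coupled p U w ->
  exists K : int, forall s y i j, s <= K -> inW2r r y -> n <= i -> n <= j ->
    matching_from phi w (2 * s + p) y (inr i) (inr j) <-> induced_matching phi U w i j.
Proof.
move=> [st pa fu /(_ r n)[t [K [tn Ut Kt h]]]]; exists K => s y i j sK yr ni nj.
have b := h s y sK yr; have st' : 2 * s + p <= t by lia.
have it : t <= i by lia. have jt : t <= j by lia.
by rewrite (matching_restart st' b it jt); exact: matching_point.
Qed.

Lemma is_limit_coupled p U w Y (m : nat -> int) : coupled p U w -> Y2inf Y ->
  to_minfty m -> (forall k, exists s, m k = 2 * s + p) ->
  is_limit (fun k => Minf phi Y (m k) w) (induced_matching phi U w).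
Proof.
move=> cU [r _ [_ Yr]] mo mp n; have [K hK] := coupled_limit r n cU.
have [N _ hN] := mo (2 * K + p); exists N => // k /hN /= mk i j ni nj.
have [s es] := mp k; rewrite /Minf es; apply: hK => //.
by rewrite es in mk; lia.
Qed.

(** A limit is determined by any subsequence of starting times. *)
Lemma limit_unique p U w Y (m : nat -> int) M : coupled p U w -> Y2inf Y ->
  to_minfty m -> is_limit (fun k => Minf phi Y (m k) w) M ->
  (forall N, exists2 k, (N <= k)%N & exists s, m k = 2 * s + p) ->
  M = induced_matching phi U w.
Proof.
move=> cU [r _ [_ Yr]] mo limM freq; apply/funext => i; apply/funext => j; apply/propext.
have [K hK] := coupled_limit r (Num.min i j) cU.
have [N1 _ h1] := mo (2 * K + p); have [N2 _ h2] := limM (Num.min i j).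
have [k Nk [s es]] := freq (maxn N1 N2).
have mi : Num.min i j <= i by rewrite ge_min lexx.
have mj : Num.min i j <= j by rewrite ge_min lexx orbT.
rewrite -(h2 k _ i j mi mj); last by rewrite /=; lia.
have /= := h1 k ltac:(rewrite /=; lia); rewrite es => sK.
by apply: hK => //; lia.
Qed.

(** A sequence of starting times is infinitely often even, or else eventually odd. *)
Lemma biinf_perfect_coupled U V w : coupled 0 U w -> coupled 1 V w ->
  [set M | biinf_matching phi w M /\ perfect M] =
    [set induced_matching phi U w; induced_matching phi V w].
Proof.
move=> cU cV; have Ynil : Y2inf (fun _ : Omega G => [::] : seq G).
  exact: Y2inf_cst (@inW2_nil G).
apply/seteqP; split=> [M [[Y [Yr [m [mo limM]]]] _]|M [] ->].
- have [freq|/existsNP[N hN]] :=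
    pselect (forall N, exists2 k, (N <= k)%N & exists s : int, m k = 2 * s + 0).
    by left; exact: (limit_unique cU Yr mo limM freq).
  right; apply: (limit_unique cV Yr mo limM) => N'.
  exists (maxn N N'); first exact: leq_maxr.
  have ne s : m (maxn N N') <> 2 * s + 0.
    by move=> e; apply: hN; exists (maxn N N'); [exact: leq_maxl|exists s].
  set x := m _ in ne *; exists ((x %/ 2)%Z).
  by have := ne ((x %/ 2)%Z); lia.
- split; last exact: coupled_perfect cU.
  exists (fun _ => [::]); split => //; exists (fun k => - k%:Z * 2); split.
    by move=> b; exists (absz b) => // k /=; lia.
  by apply: is_limit_coupled cU Ynil _ _; [move=> b; exists (absz b) => // k /=; lia|
    move=> k; exists (- k%:Z); lia].
- split; last exact: coupled_perfect cV.
  exists (fun _ => [::]); split => //; exists (fun k => - k%:Z * 2 + 1); split.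
    by move=> b; exists (absz b).+1 => // k /=; lia.
  by apply: is_limit_coupled cV Ynil _ _; [move=> b; exists (absz b).+1 => // k /=; lia|
    move=> k; exists (- k%:Z); lia].
Qed.

Lemma induced_theta U w (k : int) i j :
  (forall u : int, U u (theta k w) = U (u + k) w) ->
  induced_matching phi U (theta k w) i j <-> induced_matching phi U w (i + k) (j + k).
Proof.
move=> Uk; split=> -[s [t [[st Us Ut ne] ri rj M]]].
  exists (s + k), (t + k); split; [|lia|lia|exact/(matching_theta phi w k s [::] (inr i) (inr j))].
  split; [by lia|by rewrite /= -Uk|by rewrite /= -Uk|move=> u ru].
  by have /= := ne (u - k) ltac:(lia); rewrite Uk subrK.
exists (s - k), (t - k); split; [|lia|lia|].
  split; [by lia|by rewrite /= Uk subrK|by rewrite /= Uk subrK|move=> u ru].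
  by rewrite /= Uk; apply: ne; lia.
by apply/matching_theta; rewrite subrK.
Qed.

End limits.

(** * The two buffers started in the remote past *)

Section past_limit.
Variables (R : realType) (G : sgraph) (phi : policy R G).
Implicit Types (y : seq G) (w : Omega G).

Definition past_limit n w : seq G -> Prop := fun u =>
  exists L : int, forall s, s <= L -> buf phi w (2 * s) [::] n = u.

(** The content at time n of the systems started empty at all early enough even times; the
default value is taken on the null event where they do not coalesce. *)
Definition Wstar (n : int) w : seq G :=
  if pselect (exists u, past_limit n w u) is left h then sval (cid h) else [::].

Lemma past_limit_unique n w u v : past_limit n w u -> past_limit n w v -> u = v.
Proof.
move=> [L hL] [L' hL']; rewrite -(hL (Num.min L L')) ?ge_min ?lexx//.
by rewrite -(hL' (Num.min L L')) ?ge_min ?lexx ?orbT.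
Qed.

Lemma WstarE n w u : past_limit n w u -> Wstar n w = u.
Proof.
move=> h; rewrite /Wstar; case: pselect => [h'|[]]; last by exists u.
exact: past_limit_unique (svalP (cid h')) h.
Qed.

Lemma Wstar_cases n w : past_limit n w (Wstar n w) \/ Wstar n w = [::].
Proof. by rewrite /Wstar; case: pselect => h; [left; exact: svalP (cid h)|right]. Qed.

Lemma Wstar_theta k n w : Wstar n (theta (2 * k) w) = Wstar (n + 2 * k) w.
Proof.
have e : past_limit n (theta (2 * k) w) = past_limit (n + 2 * k) w.
  apply/funext => u; apply/propext; split=> -[L h].
    exists (L + k) => s sL; apply: etrans (h (s - k) _); last by lia.
    by rewrite buf_theta; congr buf; lia.
  exists (L - k) => s sL; apply: etrans (h (s + k) _); last by lia.
  by rewrite buf_theta; congr buf; lia.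
by rewrite /Wstar e.
Qed.

Lemma inW_Wstar n w : inW (Wstar n w).
Proof.
have [[L h]|->//] := Wstar_cases n w.
by rewrite -(h L (lexx _)); exact: inW_buf.
Qed.

Lemma inW2_Wstar n w : inW2 (Wstar (2 * n) w).
Proof.
have [[L h]|->//] := Wstar_cases (2 * n) w.
by rewrite -(h L (lexx _)); exact: inW2_buf.
Qed.

(** The default value is the empty word, so the latter must be treated as the complement
of all other values. *)
Lemma rv_Wstar n : rv (Wstar n).
Proof.
have mL u : measurable [set w | past_limit n w u].
  apply: measurable_exists => L; apply: measurable_forall => s.
  apply: measurable_imply => _; exact: (measurable_buf _ _ _ _ (fun x => x = u)).
move=> u; have [->|u0] := pselect (u = [::]).
  rewrite (_ : mkset _ = [set w | forall v, v <> [::] -> ~ past_limit n w v]).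
    apply: measurable_forall => v; apply: measurable_imply => _.
    exact: measurable_not.
  apply/seteqP; split=> w /= h; first by move=> v v0 /WstarE; rewrite h => /esym.
  by have [h'|//] := Wstar_cases n w; apply: contrapT => /h; apply.
rewrite (_ : mkset _ = [set w | past_limit n w u]) //.
apply/seteqP; split=> w /= h; last exact: WstarE.
by rewrite -h; have [//|e] := Wstar_cases n w; move: u0; rewrite -h e.
Qed.

(** The almost sure properties of the input under which the matchings are determined
realization by realization. *)
Definition regular w : Prop := [/\ hits phi w, recurs phi w &
  forall n : int, exists2 t, t <= n & coalesces phi w t].

Section regular_input.
Variable w : Omega G.
Hypothesis rw : regular w.

Lemma Wstar_buf t n : coalesces phi w t -> 2 * t <= n ->
  Wstar n w = buf phi w (2 * t) [::] n.
Proof.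
move=> [L Lt h] tn; apply: WstarE; exists L => s sL.
by rewrite (@buf_cat _ _ _ _ _ _ (2 * t)) ?h//; lia.
Qed.

Lemma coalesces_before (n : int) : exists2 t, 2 * t <= n & coalesces phi w t.
Proof.
have [_ _ /(_ (- (absz n)%:Z))[t tn c]] := rw; exists t => //; lia.
Qed.

Lemma Wstar_step (n : int) : Wstar (n + 1) w = odot phi (Wstar n w) (w n).
Proof.
have [t tn c] := coalesces_before n.
by rewrite !(Wstar_buf c) ?buf_step//; lia.
Qed.

Lemma Wstar_coalesces t : coalesces phi w t -> Wstar (2 * t) w = [::].
Proof. by move=> c; rewrite (Wstar_buf c)// bufxx. Qed.

Lemma Wstar_past (n : int) : exists2 t, t <= n & Wstar t w = [::].
Proof.
have [t tn c] := coalesces_before n; exists (2 * t) => //; exact: Wstar_coalesces.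
Qed.

Lemma Wstar_fut (n : int) : exists2 t, n < t & Wstar t w = [::].
Proof.
have [t tn c] := coalesces_before n.
have far m : exists2 r, t + m%:Z <= r & Wstar (2 * r) w = [::].
  elim: m => [|m [r tr Wr]]; first by exists t; [lia|exact: Wstar_coalesces].
  have [_ /(_ r)[r' rr' e] _] := rw; exists r'; first by lia.
  by rewrite (recursion_buf Wstar_step (s := 2 * r)) ?Wr//; lia.
have [r tr Wr] := far (absz (n - 2 * t)%R).+1.
by exists (2 * r) => //; lia.
Qed.

Lemma odd_size_Wstar (n : int) : odd (size (Wstar n w)) = odd (absz n).
Proof.
have [t tn c] := coalesces_before n.
by rewrite (Wstar_buf c)// odd_size_traj//= addbF; lia.
Qed.

(** The finitely many contents of size at most 2r have all been emptied before the time L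
from which the systems started empty coalesce. *)
Lemma coupled_Wstar : coupled phi 0 Wstar w.
Proof.
split; [exact: Wstar_step|exact: Wstar_past|exact: Wstar_fut|move=> r n].
have [t tn [L Lt h]] := coalesces_before n.
have [l lP] := words_exist G (2 * r); have [hw _ _] := rw.
have [K KL hK] : exists2 K, K <= L & forall s y, s <= K -> y \in l -> inW2 y ->
    buf phi w (2 * s) y (2 * t) = [::].
  elim: l {lP} => [|x l [K KL hK]]; first by exists L.
  have [x2|nx2] := pselect (inW2 x); last first.
    exists K => // s y sK; rewrite inE => /orP[/eqP->//|]; exact: hK.
  have [K' hK'] := hw x x2 L; exists (Num.min K K'); first by lia.
  move=> s y sK; rewrite inE => /orP[/eqP-> _|yl]; last by apply: hK yl; lia.
  have [|q sq e] := hK' s; first by lia.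
  by rewrite (@buf_cat _ _ _ _ _ _ (2 * q)) ?e ?h//; lia.
exists (2 * t), K; split=> //; first by apply: Wstar_coalesces; exists L.
  by lia.
move=> s y sK [y2 yr]; rewrite addr0; apply: hK => //; exact: lP.
Qed.

End regular_input.

(** Odd times are the even times of the input shifted by one. *)
Definition Wsstar (n : int) w : seq G := Wstar (n - 1) (theta 1 w).

Lemma coupled_Wsstar w : regular (theta 1 w) -> coupled phi 1 Wsstar w.
Proof.
move=> /coupled_Wstar[st pa fu cp]; split=> [n|n|n|r n].
- rewrite /Wsstar -[w n]/(w n); have -> : n + 1 - 1 = n - 1 + 1 by lia.
  by rewrite st thetaE subrK.
- have [t tn e] := pa (n - 1); exists (t + 1); first by lia.
  by rewrite /Wsstar addrK.
- have [t tn e] := fu (n - 1); exists (t + 1); first by lia.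
  by rewrite /Wsstar addrK.
have [t [K [tn Ut Kt h]]] := cp r (n - 1); exists (t + 1), K; split.
- by lia.
- by rewrite /Wsstar addrK.
- by lia.
by move=> s y sK yr; rewrite -(h s y sK yr) buf_theta addr0.
Qed.

Lemma Wsstar_theta k n w : Wsstar n (theta (2 * k) w) = Wsstar (n + 2 * k) w.
Proof.
rewrite /Wsstar theta_comp (addrC 1) -theta_comp Wstar_theta.
by congr Wstar; lia.
Qed.

Lemma induced_Wstar_neq w : regular w -> regular (theta 1 w) ->
  induced_matching phi Wstar w <> induced_matching phi Wsstar w.
Proof.
move=> rw rw1; have [t _ c] := coalesces_before rw 0.
have [st pa fu _] := coupled_Wsstar rw1.
apply: (induced_neq st pa fu (t := 2 * t)); first exact: Wstar_coalesces.
move=> e; have := odd_size_Wstar rw1 (2 * t - 1).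
by move: e; rewrite /Wsstar => ->; rewrite /=; lia.
Qed.

End past_limit.

(** * Stationary buffers *)

Section stationarity.
Variables (R : realType) (G : sgraph) (phi : policy R G) (mu : G -> R).
Variable P : probability (Omega G) R.
Hypothesis mu_gt0 : forall i, 0 < mu i.
Hypothesis mu_sum1 : \sum_i mu i = 1.
Hypothesis P_prod : product_measure phi P mu.
Hypothesis phi_sub : sub_additive phi.
Hypothesis tau_int : forall Y : Omega G -> seq G, Y2inf Y ->
  P.-integrable setT (tau1 phi Y).
Implicit Types (y : seq G) (w : Omega G).

Lemma ae_regular : {ae P, forall w, regular phi w}.
Proof.
have h1 := ae_hits P_prod tau_int; have h2 := ae_recurs P_prod tau_int.
have h3 := ae_coalesces mu_gt0 mu_sum1 P_prod phi_sub tau_int.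
by apply: filterS3 h1 h2 h3 => w; split.
Qed.

Lemma stationary_Wstar : stationary_buffer phi P 0 (Wstar phi).
Proof.
split=> [n| | |].
- by split; [exact: rv_Wstar|exact: inW_Wstar].
- by apply: filterS ae_regular => w rw n; exact: Wstar_step.
- by apply: aeW => w; exact: (inW2_Wstar phi 0).
- by apply: aeW => w n; rewrite Wstar_theta addrC.
Qed.

Lemma stationary_shift k p U : stationary_buffer phi P p U ->
  stationary_buffer phi P (p - k) (fun n w => U (n + k) (theta (- k) w)).
Proof.
move=> [mU stU evU shU]; split=> [n| | |].
- split=> [u|w]; last by have [_] := mU (n + k); apply.
  by have [h _] := mU (n + k); exact: (measurable_theta (- k) (h u)).
- apply: filterS (ae_theta P_prod (- k) stU) => w h n.
  by have := h (n + k); rewrite thetaE addrK addrAC.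
- by apply: filterS (ae_theta P_prod (- k) evU) => w; rewrite subrK.
- apply: filterS (ae_theta P_prod (- k) shU) => w h n.
  by rewrite addrA !subrK h !theta_comp addrC.
Qed.

(** Continuity from above of P along the sets F n. *)
Lemma ge_vanishing (F : nat -> set (Omega G)) (c x : \bar R) :
  c \is a fin_num -> (forall n, measurable (F n)) ->
  (forall m n, (m <= n)%N -> F n `<=` F m) -> P (\bigcap_n F n) = 0%E ->
  (forall n, (x <= c + P (F n))%E) -> (x <= c)%E.
Proof.
move=> cfin mF dF F0 h.
have cv : (P \o F) n @[n --> \oo] --> 0%E.
  rewrite -F0; apply: nonincreasing_cvg_mu => //.
  - by rewrite (le_lt_trans (probability_le1 _ (mF 0%N))) ?ltry.
  - exact: bigcapT_measurable.
  - by move=> m n mn; apply/subsetPset; exact: dF.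
have cv' : (c + P (F n))%E @[n --> \oo] --> c.
  rewrite -[X in _ --> X]adde0; apply: cvgeD => //; last exact: cvg_cst.
  by rewrite fin_num_adde_defr.
rewrite -(cvg_lim _ cv')//; apply: lime_ge; last exact: nearW.
by apply/cvg_ex; exists c.
Qed.

(** Let k be large. Either the content of U at time -2k exceeds 2r, which has a probability
independent of k and small for large r; or U is one of the systems that are coupled with
[Wstar] at time 0, up to an event whose probability vanishes as k grows. *)
Lemma stationary_unique0 U : stationary_buffer phi P 0 U ->
  {ae P, forall w, U 0 w = Wstar phi 0 w}.
Proof.
move=> [mU stU evU shU].
have rv0 : rv (U 0) by case: (mU 0).
pose D := [set w | U 0 w <> Wstar phi 0 w].
pose C (r n : nat) := [set w | exists k : nat, (n <= k)%N /\ exists y,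
  inW2r r y /\ buf phi w (2 * (- k%:Z)) y 0 <> Wstar phi 0 w].
pose F (r : nat) := [set w | (2 * r < size (U 0 w))%N].
have mW := rv_Wstar phi 0.
have mpair (T1 T2 : countType) (f : Omega G -> T1) (g : Omega G -> T2) (Q : T1 -> T2 -> Prop) :
    rv f -> rv g -> measurable [set w | Q (f w) (g w)].
  move=> mf mg; have mfg := @rv_comp2 _ _ _ _ _ _ pair mf mg.
  exact: (@rv_pred _ (T1 * T2)%type _ (fun v => Q v.1 v.2) mfg).
have mD : measurable D.
  exact: (mpair _ _ _ _ (fun u v => u <> v) rv0 mW).
have mC r n : measurable (C r n).
  apply: measurable_exists => k; apply: measurableI; first exact: measurable_prop.
  apply: measurable_exists => y; apply: measurableI; first exact: measurable_prop.
  exact: (mpair _ _ _ _ (fun u v => u <> v) (rv_traj phi _ _ _) mW).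
have mF r : measurable (F r).
  exact: (@rv_pred _ _ _ (fun v => (2 * r < size v)%N) rv0).
have [Nr [mNr Nr0 hNr]] := ae_regular.
have PC r : P (\bigcap_n C r n) = 0%E.
  apply: (@subset_measure0 _ _ _ _ _ Nr) => //; first exact: bigcapT_measurable.
  move=> w wC; apply: hNr => rw.
  have [_ _ _ /(_ r 0)[t [K [t0 Ut Kt h]]]] := coupled_Wstar rw.
  have [k [Kk [y [yr]]]] := wC (absz K) Logic.I; apply.
  have sK : - k%:Z <= K by lia.
  have := h _ y sK yr; rewrite addr0 => e.
  rewrite (@buf_cat _ _ _ _ _ _ t) ?e; [|lia|lia].
  by rewrite (recursion_buf (Wstar_step rw) t0) Ut.
have bound r n : (P D <= P (F r) + P (C r n))%E.
  pose F' := [set w | F r (theta (2 * (- n%:Z)) w)].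
  have mF' : measurable F' by exact: measurable_theta (mF r).
  have [N [mN N0 hN]] : {ae P, forall w, D w -> F' w \/ C r n w}.
    apply: filterS3 stU (ae_theta P_prod (2 * (- n%:Z)) evU) shU => w st ev sh wD.
    have [lt|le] := ltnP (2 * r) (size (U 0 (theta (2 * (- n%:Z)) w))); first by left.
    right; exists n; split => //; exists (U (2 * - n%:Z + 0) w); rewrite sh; split => //.
    move=> e; apply: wD; rewrite -e -sh addr0; apply: (recursion_buf st); lia.
  rewrite -(theta_preserving P_prod (2 * (- n%:Z)) (mF r)).
  apply: (@le_trans _ _ (P (N `|` (F' `|` C r n)))).
    apply: le_measure; rewrite ?inE//; first by apply: measurableU => //; exact: measurableU.
    move=> w wD; have [wN|wN] := pselect (N w); first by left.
    by right; apply: contrapT => nF; apply: wN; apply: hN => /(_ wD).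
  apply: le_trans (measureU2 _ _ _) _ => //; first exact: measurableU.
  by rewrite [X in (X + _)%E]N0 add0e; exact: measureU2.
have Dr r : (P D <= 0 + P (F r))%E.
  rewrite add0e; apply: (ge_vanishing _ (mC r) _ (PC r)) => //.
    by rewrite fin_num_measure.
  by move=> m n mn w [k [nk h]]; exists k; split => //; exact: leq_trans mn nk.
exists D; split => //; apply/eqP; rewrite -measure_le0.
apply: (ge_vanishing _ mF _ _ Dr) => //.
  by move=> m n mn w; rewrite /F /=; lia.
rewrite (_ : \bigcap_n F n = set0) ?measure0//; apply/seteqP.
split=> // w /(_ (size (U 0 w)) Logic.I).
by rewrite /F /= ltnNge leq_pmull.
Qed.

Lemma stationary_unique U : stationary_buffer phi P 0 U ->
  {ae P, forall w, forall n : int, U n w = Wstar phi n w}.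
Proof.
move=> sU; have e0 := stationary_unique0 sU; have [_ stU _ shU] := sU.
have e0' : {ae P, forall w, forall n : int,
    U 0 (theta (2 * n) w) = Wstar phi 0 (theta (2 * n) w)}.
  by apply: ae_forall => n; exact: (ae_theta P_prod (2 * n) e0).
have rg := ae_regular.
have : {ae P, forall w, forall n : int, U (2 * n) w = Wstar phi (2 * n) w}.
  apply: filterS2 shU e0' => w sh e n.
  by have := sh n; rewrite addr0 => ->; rewrite e Wstar_theta add0r.
apply: filterS3 stU rg => w st rw e n.
have ev : n = 2 * (n %/ 2)%Z \/ n = 2 * (n %/ 2)%Z + 1 by lia.
by case: ev => ->; rewrite ?e// st e (Wstar_step rw).
Qed.

Lemma the_stationary_Wstar : the_stationary_buffer phi P 0 (Wstar phi).
Proof. by split; [exact: stationary_Wstar|exact: stationary_unique]. Qed.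

Lemma the_stationary_Wsstar : the_stationary_buffer phi P 1 (Wsstar phi).
Proof.
split; first exact: (stationary_shift (-1) stationary_Wstar).
move=> U /(stationary_shift 1); rewrite subrr => /stationary_unique e.
apply: filterS (ae_theta P_prod 1 e) => w h n.
by rewrite /Wsstar -h subrK theta_comp addNr theta0.
Qed.

End stationarity.

Theorem corollary4 (R : realType) (G : sgraph) (phi : policy R G)
    (mu : G -> R) (mu_gt0 : forall i, 0 < mu i) (mu_sum1 : \sum_i mu i = 1)
    (P : probability (Omega G) R) (P_prod : product_measure phi P mu)
    (phi_sub : sub_additive phi)
    (tau_int : forall Y : Omega G -> seq G, Y2inf Y ->
       P.-integrable setT (tau1 phi Y)) :
  exists Ws Wss : int -> Omega G -> seq G,
    [/\ the_stationary_buffer phi P 0 Ws /\ the_stationary_buffer phi P 1 Wss,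
        stationary_matching P (induced_matching phi Ws) /\
        stationary_matching P (induced_matching phi Wss),
        {ae P, forall w,
          [set M | biinf_matching phi w M /\ perfect M] =
            [set induced_matching phi Ws w; induced_matching phi Wss w] /\
          induced_matching phi Ws w <> induced_matching phi Wss w} &
        forall Y : Omega G -> seq G, Y2inf Y ->
          {ae P, forall w,
            is_limit (fun k => Minf phi Y (- (2 * k)%N%:Z) w)
              (induced_matching phi Ws w) /\
            is_limit (fun k => Minf phi Y (- (2 * k)%N%:Z + 1) w)
              (induced_matching phi Wss w)}].
Proof.
have rg := ae_regular mu_gt0 mu_sum1 P_prod phi_sub tau_int.
have rg1 := ae_theta P_prod 1 rg.
exists (Wstar phi), (Wsstar phi); split.
- split; first exact: (the_stationary_Wstar mu_gt0 mu_sum1 P_prod phi_sub tau_int).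
  exact: (the_stationary_Wsstar mu_gt0 mu_sum1 P_prod phi_sub tau_int).
- split; apply: aeW => w n i j; apply: induced_theta => u.
    exact: Wstar_theta.
  exact: Wsstar_theta.
- apply: filterS2 rg rg1 => w rw rw1; split; last exact: induced_Wstar_neq.
  by apply: biinf_perfect_coupled; [exact: coupled_Wstar|exact: coupled_Wsstar].
- move=> Y YY; apply: filterS2 rg rg1 => w rw rw1; split.
    apply: (is_limit_coupled (coupled_Wstar rw) YY).
      by move=> b; exists (absz b) => // k /=; lia.
    by move=> k; exists (- k%:Z); lia.
  apply: (is_limit_coupled (coupled_Wsstar rw1) YY).
    by move=> b; exists (absz b).+1 => // k /=; lia.
  by move=> k; exists (- k%:Z); lia.
Qed.
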